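(* Let $R=k[x_1,\ldots,x_d]$ be a (standard graded) polynomial ring over a field $k$, let $\mathfrak m=(x_1,\ldots,x_d)$, let $I$ be a homogeneous ideal of $R$, and fix an integer $i\geq 0$. Then for every $\alpha\in\mathbb{Z}$ we have $$\limsup_{n\to\infty}\frac{\lambda(\operatorname{H}^i_{\mathfrak m}(R/I^n)_{\geq -\alpha n})}{n^d}<\infty.$$
   Context: $\lambda(-)$ denotes length and $\operatorname{H}^i_{\mathfrak m}(-)$ local cohomology with its natural $\mathbb{Z}$-grading. For a graded module $M=\bigoplus_{j\in\mathbb{Z}}M_j$ and $a\in\mathbb{Z}$, $M_{\geq a}=\bigoplus_{j\geq a}M_j$. *)

(* Defs.v *)
From HB Require Import structures.
From mathcomp Require Import all_boot all_order all_algebra generic_quotient.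
From mathcomp Require Import ring_quotient zify ring.
(* mpoly must be imported before sequences: in the other order, the notations
   of the two files clash. *)
From mathcomp Require Import mpoly.
From mathcomp Require Import boolp classical_sets reals constructive_ereal ereal.
From mathcomp Require Import sequences.
Set Implicit Arguments.
Unset Strict Implicit.
Unset Printing Implicit Defensive.
Import Order.TTheory GRing.Theory Num.Theory.
Local Open Scope classical_set_scope.
Local Open Scope ring_scope.
Local Open Scope quotient_scope.

Section QuotientModule.
Variables (R : comNzRingType) (M : lmodType R) (N : submodClosed M).

(* submodClosed, defined over semirings, does not inherit from zmodClosed,
   which the library quotient requires. *)
Definition submod_pred : {pred M} := N.

Fact submod_pred_zmod_closed : zmod_closed submod_pred.
Proof.
split; first exact: (@rpred0 _ N).
by move=> x y Nx Ny; rewrite -scaleN1r; apply: (@rpredD _ N) => //; apply: rpredZ.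
Qed.
HB.instance Definition _ :=
  GRing.isZmodClosed.Build M submod_pred submod_pred_zmod_closed.

Definition quotmod : Type := Quotient.quot submod_pred.
HB.instance Definition _ := GRing.Zmodule.on quotmod.

Definition mclass (x : M) : quotmod := \pi_(Quotient.quot submod_pred) x.

Lemma mclassP (x y : M) : mclass x = mclass y <-> x - y \in N.
Proof.
rewrite -[x - y \in N]/(x - y \in submod_pred) Quotient.idealrBE.
by split=> [/eqP|/eqP].
Qed.

Lemma mclass_surj (x : quotmod) : exists m, x = mclass m.
Proof. by exists (repr (x : Quotient.quot submod_pred)); rewrite /mclass reprK. Qed.

Lemma mclassD : {morph mclass : x y / x + y}.
Proof. by move=> x y; rewrite /mclass Quotient.pi_add. Qed.

Definition quotmod_scale (r : R) (x : quotmod) : quotmod :=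
  mclass (r *: repr (x : Quotient.quot submod_pred)).

Lemma mclass_scale r x : quotmod_scale r (mclass x) = mclass (r *: x).
Proof.
apply/mclassP; rewrite -scalerBr rpredZ //; apply/mclassP.
by rewrite /mclass reprK.
Qed.

Fact quotmod_scaleA a b v :
  quotmod_scale a (quotmod_scale b v) = quotmod_scale (a * b) v.
Proof. by case: (mclass_surj v) => m ->; rewrite !mclass_scale scalerA. Qed.
Fact quotmod_scale1 : left_id 1 quotmod_scale.
Proof. by move=> v; case: (mclass_surj v) => m ->; rewrite mclass_scale scale1r. Qed.
Fact quotmod_scaleDr : right_distributive quotmod_scale +%R.
Proof.
move=> a u v; case: (mclass_surj u) (mclass_surj v) => m -> [n ->].
by rewrite -mclassD !mclass_scale -mclassD scalerDr.
Qed.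
Fact quotmod_scaleDl v : {morph quotmod_scale^~ v : a b / a + b}.
Proof.
move=> a b; case: (mclass_surj v) => m ->.
by rewrite !mclass_scale -mclassD scalerDl.
Qed.
HB.instance Definition _ := GRing.Zmodule_isLmodule.Build R quotmod
  quotmod_scaleA quotmod_scale1 quotmod_scaleDr quotmod_scaleDl.

End QuotientModule.

(* The chains are N 0 < N 1 < ... < N l. When P is a submodule, this is the
   length of P as an R-module (+oo if it is not finite). *)
Definition mlength (Real : realType) (R : nzRingType) (M : lmodType R)
    (P : set M) : \bar Real :=
  ereal_sup [set l%:R%:E | l in [set l : nat |
    exists N : nat -> submodClosed M,
      (forall t, (t <= l)%N -> forall x, x \in N t -> P x) /\
      (forall t, (t < l)%N -> {subset N t <= N t.+1} /\
                              exists2 x, x \in N t.+1 & x \notin N t)]].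

(* For a graded module with pieces P j, the submodule of elements of degree
   at least a. *)
Definition ge_part (R : nzRingType) (M : lmodType R) (P : int -> set M)
    (a : int) : set M :=
  [set x | exists (s : nat) (h : nat -> M),
    (forall t : nat, P (a + t%:Z) (h t)) /\ x = \sum_(t < s) h t].

Lemma scale_swap (R : comNzRingType) (M : lmodType R) (a b : R) (m : M) :
  a *: (b *: m) = b *: (a *: m).
Proof. by rewrite !scalerA mulrC. Qed.

Section Localization.
Variables (R : comNzRingType) (M : lmodType R) (f : R).

(* The pair (m, a) stands for the fraction m / f ^+ a. *)
Definition loc_equiv (u v : M * nat) : bool :=
  `[< exists c, f ^+ (c + v.2) *: u.1 = f ^+ (c + u.2) *: v.1 >].

Lemma loc_equiv_is_equiv : equiv_class_of loc_equiv.
Proof.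
split=> [u|u v|v u w].
- by apply/asboolP; exists 0%N.
- by apply/asboolP/asboolP => -[c h]; exists c.
move=> /asboolP[c h] /asboolP[e g]; apply/asboolP; exists (c + e + v.2)%N.
have -> : (c + e + v.2 + w.2 = (e + w.2) + (c + v.2))%N by lia.
have -> : (c + e + v.2 + u.2 = (c + u.2) + (e + v.2))%N by lia.
by rewrite exprD -scalerA h scalerA mulrC -scalerA g scalerA -exprD.
Qed.

Canonical loc_equiv_equiv := EquivRelPack loc_equiv_is_equiv.
Canonical loc_equiv_encModRel := defaultEncModRel loc_equiv.

Definition loc : Type := {eq_quot loc_equiv}.
HB.instance Definition _ := Choice.on loc.

Definition frac (m : M) (a : nat) : loc := \pi_({eq_quot loc_equiv}) (m, a).
Definition locnum (x : loc) : M := (repr (x : {eq_quot loc_equiv})).1.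
Definition locexp (x : loc) : nat := (repr (x : {eq_quot loc_equiv})).2.

Lemma fracP m a n b :
  frac m a = frac n b <-> exists c, f ^+ (c + b) *: m = f ^+ (c + a) *: n.
Proof.
split=> [/eqP|h]; last by apply/eqP; rewrite /frac piE; apply/asboolP.
by rewrite /frac piE => /asboolP.
Qed.

Lemma fracK x : frac (locnum x) (locexp x) = x.
Proof. by rewrite /frac /locnum /locexp -surjective_pairing reprK. Qed.

Lemma frac_surj x : exists m a, x = frac m a.
Proof. by exists (locnum x), (locexp x); rewrite fracK. Qed.

Definition loc_add (x y : loc) : loc :=
  frac (f ^+ locexp y *: locnum x + f ^+ locexp x *: locnum y)
       (locexp x + locexp y).
Definition loc_opp (x : loc) : loc := frac (- locnum x) (locexp x).
Definition loc_scale (r : R) (x : loc) : loc := frac (r *: locnum x) (locexp x).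

Lemma loc_addE m a n b :
  loc_add (frac m a) (frac n b) = frac (f ^+ b *: m + f ^+ a *: n) (a + b).
Proof.
rewrite /loc_add.
have /fracP[c hc] := fracK (frac m a); have /fracP[e he] := fracK (frac n b).
move: (locnum _) (locexp _) hc (locnum _) (locexp _) he => m' a' hc n' b' he.
apply/fracP; exists (c + e)%N; rewrite !scalerDr !scalerA -!exprD; congr (_ + _).
  have -> : (c + e + (a + b) + b' = (e + b + b') + (c + a))%N by lia.
  by rewrite exprD -scalerA hc scalerA -exprD; congr (f ^+ _ *: _); lia.
have -> : (c + e + (a + b) + a' = (c + a + a') + (e + b))%N by lia.
by rewrite exprD -scalerA he scalerA -exprD; congr (f ^+ _ *: _); lia.
Qed.

Lemma loc_oppE m a : loc_opp (frac m a) = frac (- m) a.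
Proof.
rewrite /loc_opp; have /fracP[c hc] := fracK (frac m a).
by apply/fracP; exists c; rewrite !scalerN hc.
Qed.

Lemma loc_scaleE r m a : loc_scale r (frac m a) = frac (r *: m) a.
Proof.
rewrite /loc_scale; have /fracP[c hc] := fracK (frac m a).
by apply/fracP; exists c; rewrite !(scale_swap _ r) hc.
Qed.

Fact loc_addA : associative loc_add.
Proof.
move=> x y z; case: (frac_surj x) (frac_surj y) (frac_surj z)
  => m [a ->] [n [b ->]] [p [c ->]].
rewrite !loc_addE addnA; congr frac.
by rewrite !scalerDr !scalerA -!exprD -addrA (addnC c b) (addnC c a).
Qed.
Fact loc_addC : commutative loc_add.
Proof.
move=> x y; case: (frac_surj x) (frac_surj y) => m [a ->] [n [b ->]].
by rewrite !loc_addE addrC addnC.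
Qed.
Fact loc_add0 : left_id (frac 0 0) loc_add.
Proof.
move=> x; case: (frac_surj x) => m [a ->].
by rewrite loc_addE scaler0 add0r expr0 scale1r add0n.
Qed.
Fact loc_addN : left_inverse (frac 0 0) loc_opp loc_add.
Proof.
move=> x; case: (frac_surj x) => m [a ->].
rewrite loc_oppE loc_addE scalerN addNr.
by apply/fracP; exists 0%N; rewrite !scaler0.
Qed.
HB.instance Definition _ :=
  GRing.isZmodule.Build loc loc_addA loc_addC loc_add0 loc_addN.

Lemma fracD m a n b :
  frac m a + frac n b = frac (f ^+ b *: m + f ^+ a *: n) (a + b).
Proof. exact: loc_addE. Qed.

Lemma fracDl m n a : frac (m + n) a = frac m a + frac n a.
Proof.
rewrite fracD -scalerDr; apply/fracP; exists 0%N.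
by rewrite scalerA -exprD; congr (f ^+ _ *: _); lia.
Qed.

Fact loc_scaleA a b v : loc_scale a (loc_scale b v) = loc_scale (a * b) v.
Proof. by case: (frac_surj v) => m [e ->]; rewrite !loc_scaleE scalerA. Qed.
Fact loc_scale1 : left_id 1 loc_scale.
Proof. by move=> v; case: (frac_surj v) => m [e ->]; rewrite loc_scaleE scale1r. Qed.
Fact loc_scaleDr : right_distributive loc_scale +%R.
Proof.
move=> r x y; case: (frac_surj x) (frac_surj y) => m [a ->] [n [b ->]].
by rewrite !(fracD, loc_scaleE) scalerDr !(scale_swap r).
Qed.
Fact loc_scaleDl v : {morph loc_scale^~ v : a b / a + b}.
Proof.
move=> r s; case: (frac_surj v) => m [a ->].
by rewrite !loc_scaleE scalerDl fracDl.
Qed.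
HB.instance Definition _ := GRing.Zmodule_isLmodule.Build R loc
  loc_scaleA loc_scale1 loc_scaleDr loc_scaleDl.

Lemma fracZ r m a : r *: frac m a = frac (r *: m) a.
Proof. exact: loc_scaleE. Qed.

(* The degree j elements of the localization, where P j are the graded pieces
   of M and f is homogeneous of degree e. *)
Definition loc_piece (P : int -> set M) (e : nat) (j : int) : set loc :=
  [set x | exists m a, P (j + (a * e)%N%:Z) m /\ x = frac m a].

End Localization.

(* The canonical map from the localization at f to the localization at h,
   m / f ^+ a |-> g ^+ a *: m / h ^+ a, when h = g * f; it is not meaningful
   otherwise. *)
Definition loc_map (R : comNzRingType) (M : lmodType R) (f g h : R)
    (x : loc M f) : loc M h :=
  frac h (g ^+ locexp x *: locnum x) (locexp x).

Section LocMap.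
Variables (R : comNzRingType) (M : lmodType R) (f g h : R).
Hypothesis hE : h = g * f.

Lemma loc_mapE (m : M) a : loc_map g h (frac f m a) = frac h (g ^+ a *: m) a.
Proof.
rewrite /loc_map; have /fracP[c hc] := fracK (frac f m a).
apply/fracP; exists c; rewrite !scalerA hE !exprMn.
have E b b' : g ^+ (c + b) * f ^+ (c + b) * g ^+ b' =
    g ^+ (c + b + b') * f ^+ (c + b) by rewrite mulrAC -exprD.
by rewrite !E -!scalerA hc; congr (g ^+ _ *: _); lia.
Qed.

Lemma loc_map_linear : linear (loc_map g h : loc M f -> loc M h).
Proof.
move=> r x y; case: (frac_surj x) (frac_surj y) => m [a ->] [n [b ->]].
rewrite fracZ fracD !loc_mapE fracZ fracD scalerDr !scalerA hE !exprMn exprD.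
by congr (frac _ (_ *: _ + _ *: _) _); ring.
Qed.
End LocMap.

Section DependentProduct.
Variables (R : nzRingType) (J : Type) (M : J -> lmodType R).

Definition dprod : Type := forall i, M i.
HB.instance Definition _ := gen_eqMixin dprod.
HB.instance Definition _ := gen_choiceMixin dprod.

Implicit Types u v w : dprod.
Definition dprod_add u v : dprod := fun i => u i + v i.
Definition dprod_opp u : dprod := fun i => - u i.
Definition dprod_scale (r : R) u : dprod := fun i => r *: u i.

Fact dprod_addA : associative dprod_add.
Proof. by move=> u v w; apply: functional_extensionality_dep => i; exact: addrA. Qed.
Fact dprod_addC : commutative dprod_add.
Proof. by move=> u v; apply: functional_extensionality_dep => i; exact: addrC. Qed.
Fact dprod_add0 : left_id (fun=> 0) dprod_add.
Proof. by move=> u; apply: functional_extensionality_dep => i; exact: add0r. Qed.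
Fact dprod_addN : left_inverse (fun=> 0) dprod_opp dprod_add.
Proof. by move=> u; apply: functional_extensionality_dep => i; exact: addNr. Qed.
HB.instance Definition _ :=
  GRing.isZmodule.Build dprod dprod_addA dprod_addC dprod_add0 dprod_addN.

Fact dprod_scaleA a b v : dprod_scale a (dprod_scale b v) = dprod_scale (a * b) v.
Proof. by apply: functional_extensionality_dep => i; exact: scalerA. Qed.
Fact dprod_scale1 : left_id 1 dprod_scale.
Proof. by move=> u; apply: functional_extensionality_dep => i; exact: scale1r. Qed.
Fact dprod_scaleDr : right_distributive dprod_scale +%R.
Proof. by move=> a u v; apply: functional_extensionality_dep => i; exact: scalerDr. Qed.
Fact dprod_scaleDl v : {morph dprod_scale^~ v : a b / a + b}.
Proof. by move=> a b; apply: functional_extensionality_dep => i; exact: scalerDl. Qed.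
HB.instance Definition _ := GRing.Zmodule_isLmodule.Build R dprod
  dprod_scaleA dprod_scale1 dprod_scaleDr dprod_scaleDl.
End DependentProduct.

(* Local cohomology with support in m = ('X_0, ..., 'X_(d-1)), as the cohomology
   of the Cech complex of M on the variables, whose i-th term is the product of
   the localizations of M at 'X_S, the product of the variables in S, over the
   sets S of size i. *)
Section LocalCohomology.
Variables (k : fieldType) (d : nat).
Local Notation R := {mpoly k[d]}.

Definition varprod (S : {set 'I_d}) : R := \prod_(j in S) 'X_j.

Lemma varprodD1 (S : {set 'I_d}) (j : 'I_d) :
  j \in S -> varprod S = 'X_j * varprod (S :\ j).
Proof. by move=> jS; rewrite /varprod (big_setD1 j). Qed.

Variable M : lmodType R.

(* The direct sum of all the terms of the complex; the i-th term consists of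
   the families supported on the sets of size i. *)
Definition cech : Type := dprod (fun S : {set 'I_d} => loc M (varprod S)).
HB.instance Definition _ := GRing.Lmodule.on cech.

Definition cech_term (i : nat) : set cech :=
  [set c | forall S : {set 'I_d}, #|S| != i -> c S = 0].

Definition cech_diff (c : cech) : cech := fun S =>
  \sum_(j in S) (-1) ^+ #|[set l in S | (l < j)%N]|
    *: loc_map 'X_j (varprod S) (c (S :\ j)).

Lemma cech_diff_linear : linear cech_diff.
Proof.
move=> r b c; apply: functional_extensionality_dep => S.
rewrite /cech_diff; transitivity (r *: (\sum_(j in S)
    (-1 : R) ^+ #|[set l in S | (l < j)%N]|
      *: loc_map 'X_j (varprod S) (b (S :\ j))) +
  \sum_(j in S) (-1 : R) ^+ #|[set l in S | (l < j)%N]|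
      *: loc_map 'X_j (varprod S) (c (S :\ j))); last by [].
rewrite scaler_sumr -big_split /=; apply: eq_bigr => j jS.
have H := loc_map_linear (M := M) (varprodD1 jS) r (b (S :\ j)) (c (S :\ j)).
transitivity ((-1 : R) ^+ #|[set l in S | (l < j)%N]|
  *: loc_map 'X_j (varprod S) (r *: b (S :\ j) + c (S :\ j))); first by [].
by rewrite [X in _ *: X]H scalerDr; congr (_ + _); apply: scale_swap.
Qed.

Definition cech_cocycle (i : nat) : set cech :=
  [set z | cech_term i z /\ cech_diff z = 0].

(* The condition on b says that b lies in the term of index i - 1; it forces
   b = 0 when i = 0. *)
Definition cech_boundary (i : nat) : {pred cech} :=
  [pred c | `[< exists2 b : cech,
    forall S : {set 'I_d}, #|S|.+1 != i -> b S = 0 & c = cech_diff b >]].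

Fact cech_boundary_submod_closed i : submod_closed (cech_boundary i).
Proof.
split=> [|r u v /asboolP[b hb ->] /asboolP[c hc ->]].
  apply/asboolP; exists 0 => //.
  by move: (cech_diff_linear (-1) 0 0); rewrite scaler0 addr0 scaleN1r addNr.
apply/asboolP; exists (r *: b + c); last by rewrite cech_diff_linear.
move=> S hS; transitivity (r *: b S + c S) => //.
by rewrite hb // hc // scaler0 addr0.
Qed.
HB.instance Definition _ i := GRing.isSubmodClosed.Build R cech
  (cech_boundary i) (cech_boundary_submod_closed i).

(* H^i_m(M) is the submodule of this module consisting of the classes of the
   cocycles of index i. *)
Definition lc_ambient (i : nat) : lmodType R := quotmod (cech_boundary i).

Definition cech_piece (P : int -> set M) (j : int) : set cech :=
  [set c | forall S : {set 'I_d}, loc_piece P #|S| j (c S)].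

(* The degree j component of H^i_m(M), where P is the grading of M. *)
Definition lc_piece (P : int -> set M) (i : nat) (j : int) :
    set (lc_ambient i) :=
  [set h | exists2 z, cech_cocycle i z /\ cech_piece P j z
                    & h = mclass (cech_boundary i) z].

End LocalCohomology.
Arguments lc_piece {k d M} P i j.

Section IdealPower.
Variable R : comNzRingType.

(* The finite linear combinations of products of n elements of I. *)
Definition ideal_power (I : {pred R^o}) (n : nat) : {pred R^o} :=
  [pred p : R^o | `[< exists2 s : seq (R * n.-tuple R),
    (forall t, t \in s -> forall y, y \in t.2 -> (y : R^o) \in I)
    & p = \sum_(t <- s) t.1 * \prod_(y <- t.2) y >]].

Fact ideal_power_submod_closed I n : submod_closed (ideal_power I n).
Proof.
split=> [|r u v /asboolP[s hs ->] /asboolP[t ht ->]]; apply/asboolP.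
  by exists [::]; rewrite ?big_nil.
exists ([seq (r * w.1, w.2) | w <- s] ++ t).
  by move=> w; rewrite mem_cat => /orP[/mapP[w' /hs h ->]|/ht].
rewrite big_cat big_map scaler_sumr /=; congr (_ + _).
by apply: eq_bigr => w _; rewrite /= -mulrA.
Qed.
HB.instance Definition _ I n := GRing.isSubmodClosed.Build R R^o
  (ideal_power I n) (ideal_power_submod_closed I n).
End IdealPower.

Section Graded.
Variables (k : fieldType) (d : nat).
Local Notation R := {mpoly k[d]}.

(* The ideals of R are the submodules of R^o. *)
Definition homogeneous_ideal (I : submodClosed R^o) : Prop :=
  forall (p : R) (n : nat), p \in I -> (pihomog mdeg n p : R^o) \in I.

(* The condition puts 0 in every degree, and only 0 in negative degrees. *)
Definition mpoly_piece (j : int) : set (R^o) :=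
  [set p : R | forall m, m \in msupp p -> (mdeg m)%:Z = j].

Definition quot_piece (N : submodClosed R^o) (j : int) : set (quotmod N) :=
  [set mclass N p | p in mpoly_piece j].
End Graded.
Arguments quot_piece {k d} N j.

(* Main.v *)
Require Import Defs.
From mathcomp Require Import all_boot all_order all_algebra.
From mathcomp Require Import ring_quotient zify ring.
From mathcomp Require Import mpoly.
From mathcomp Require Import boolp classical_sets reals constructive_ereal ereal.
From mathcomp Require Import sequences.
Import Order.TTheory GRing.Theory Num.Theory.
Local Open Scope ring_scope.

(** Write rees for the Rees algebra of I, the direct sum of the I^n, bigraded by n
    and by the internal degree j, and h(M)_j for the dimension of the degree j part
    of the total local cohomology of M. The quotient R / I^n is filtered by the
    I^m / I^(m+1) for m < n, so it suffices to bound the cohomology of the pieces of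
    the associated graded ring, cumulatively in m.

    More generally, let L be a bihomogeneous ideal of rees such that the sum of the
    dimensions of the pieces (n, j) of rees / L with n, j <= s is O(s^e). The claim
    [tame_rees] is that the cohomology of the n-th piece of rees / L vanishes in
    degrees above some C(n + 1), and that its total dimension over the pieces
    m <= n and the degrees at least -a is O((n + a + 1)^e). For the associated graded
    ring e = d works, because for fixed j the dimensions of its
    pieces add up to at most that of R_j.

    The claim is proved by Noetherian induction on L ([rees_induction]).
    If all variables lie in L, the cohomology is rees / L itself, which lives in
    degrees j <= C n because I^n is generated in such degrees ([tame_torsion]).
    Otherwise let x be a variable not in L. If x is a zero divisor modulo L, then
    L : x and L + x rees are both larger than L, and the exact sequence
      0 -> rees/(L : x)(-1) -> rees/L -> rees/(L + x rees) -> 0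
    reduces the claim to them ([tame_colonX_addX]). If x is a nonzerodivisor, the
    exact sequence 0 -> rees/L(-1) -> rees/L -> rees/(L + x rees) -> 0 gives
      h(rees/L)_j <= h(rees/L)_(j+1) + h(rees/(L + x rees))_(j+1)
    in each n. Where the last term vanishes, x is injective on cohomology, and since
    it acts locally nilpotently there the cohomology of rees / L vanishes as well
    ([coh_vanish]). Descending from that range bounds h(rees/L)_j by a sum of
    the terms for L + x rees; these have exponent e - 1, because the Hilbert function
    of rees / (L + x rees) is the difference of that of rees / L
    ([growth_addX_inj]), and the number of degrees j involved is linear in n + a
    ([tame_addX_inj]).

    Cohomology is computed with Cech cochains of R itself, a subquotient K / L of R
    being treated by working modulo cochains with values in L. The length of a
    module is at most its dimension over k ([mlength_le]). *)

Set Implicit Arguments.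
Unset Strict Implicit.
Unset Printing Implicit Defensive.

(** * Dimension of a space modulo a subspace *)

Section SpanModulo.
Local Open Scope classical_set_scope.
Local Open Scope ring_scope.
Variables (k : fieldType) (d : nat).
Local Notation R := {mpoly k[d]}.

Section OneModule.
Variable V : lmodType R.
Implicit Types (Z B W : set V) (u v z : V).

(** The spaces to be measured are modules over the polynomial ring; the field
    acts on them through the constant polynomials. *)
Definition ksub B : Prop :=
  B 0 /\ forall (c : k) u v, B u -> B v -> B (c%:MP *: u + v).

Lemma ksub0 B : ksub B -> B 0. Proof. by case. Qed.

Lemma ksubD B u v : ksub B -> B u -> B v -> B (u + v).
Proof. by case=> _ h Bu Bv; have := h 1 _ _ Bu Bv; rewrite scale1r. Qed.

Lemma ksubZ B (c : k) u : ksub B -> B u -> B (c%:MP *: u).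
Proof. by case=> B0 h Bu; have := h c _ _ Bu B0; rewrite addr0. Qed.

Lemma ksubN B u : ksub B -> B u -> B (- u).
Proof. by move=> hB Bu; have := ksubZ (-1) hB Bu; rewrite mpolyCN scaleN1r. Qed.

Lemma ksubB B u v : ksub B -> B u -> B v -> B (u - v).
Proof. by move=> hB Bu Bv; apply: ksubD => //; apply: ksubN. Qed.

Lemma ksub_sum B (J : Type) (s : seq J) (P : pred J) (F : J -> V) :
  ksub B -> (forall t, P t -> B (F t)) -> B (\sum_(t <- s | P t) F t).
Proof.
by move=> hB h; apply: big_ind => //; [exact: ksub0|move=> *; apply: ksubD].
Qed.

(** For subspaces Z and B this is dim (Z + B)/B <= n. The spanning vectors are
    not required to lie in Z, so that the notion is visibly monotone in Z. *)
Definition dimle Z B (n : nat) : Prop :=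
  exists v : nat -> V, forall z, Z z ->
    exists c : nat -> k, B (z - \sum_(t < n) (c t)%:MP *: v t).

Lemma dimle_sub Z Z' B B' n : (forall z, Z' z -> Z z) -> (forall z, B z -> B' z) ->
  dimle Z B n -> dimle Z' B' n.
Proof.
by move=> ZZ BB [v h]; exists v => z /ZZ /h[c /BB hc]; exists c.
Qed.

Lemma dimle_le Z B m n : (m <= n)%N -> dimle Z B m -> dimle Z B n.
Proof.
move=> mn [v h]; exists v => z /h[c hc].
exists (fun t => if (t < m)%N then c t else 0).
have -> // : \sum_(t < n) (if (t < m)%N then c t else 0)%:MP *: v t =
  \sum_(t < m) (c t)%:MP *: v t.
rewrite (big_ord_widen n (fun t => (c t)%:MP *: v t)) // [RHS]big_mkcond /=.
by apply: eq_bigr => t _; case: ifP => // _; rewrite mpolyC0 scale0r.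
Qed.

Lemma dimle0 Z B : (forall z, Z z -> B z) -> dimle Z B 0.
Proof.
by move=> h; exists (fun=> 0) => z /h Bz; exists (fun=> 0); rewrite big_ord0 subr0.
Qed.

Lemma dimle0P Z B : dimle Z B 0 -> forall z, Z z -> B z.
Proof. by case=> v h z /h[c]; rewrite big_ord0 subr0. Qed.

Lemma sum_if_scale n (c e : nat -> k) (v w : nat -> V) :
  \sum_(t < n) (if (t < n)%N then c t else e t)%:MP
      *: (if (t < n)%N then v t else w t) = \sum_(t < n) (c t)%:MP *: v t.
Proof. by apply: eq_bigr => t _; rewrite ltn_ord. Qed.

Lemma dimleS Z B n v :
  dimle Z [set u | exists c : k, B (u - c%:MP *: v)] n -> dimle Z B n.+1.
Proof.
case=> w h; exists (fun t => if (t < n)%N then w t else v) => z /h[c [e he]].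
exists (fun t => if (t < n)%N then c t else e).
by rewrite big_ord_recr /= ltnn opprD addrA (sum_if_scale _ c (fun=> e) w (fun=> v)).
Qed.

(** The spanning vectors can be taken in Z: a vector outside Z is either
    useless or can be exchanged for an element of Z. *)
Lemma dimle_in Z B n : ksub Z -> ksub B -> dimle Z B n ->
  exists2 v : nat -> V, forall t, Z (v t) & forall z, Z z ->
    exists c : nat -> k, B (z - \sum_(t < n) (c t)%:MP *: v t).
Proof.
move=> hZ; elim: n B => [|n IH] B hB.
  move=> /dimle0P h; exists (fun=> 0) => [_|z /h Bz]; first exact: ksub0.
  by exists (fun=> 0); rewrite big_ord0 subr0.
case=> v h; pose B1 : set V := [set u | exists c : k, B (u - c%:MP *: v n)].
have hB1 : ksub B1.
  split; first by exists 0; rewrite mpolyC0 scale0r subr0; exact: ksub0.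
  move=> c x y [a ha] [b hb]; exists (c * a + b).
  rewrite mpolyCD mpolyCM scalerDl -scalerA opprD addrACA -scalerBr.
  by case: hB => _; apply.
have /(IH _ hB1)[w Zw hw] : dimle Z B1 n.
  exists v => z /h[c]; rewrite big_ord_recr /= opprD addrA => hc.
  by exists c, (c n).
have [[z0 [c [Zz0 c0 hc]]]|no] :=
    pselect (exists z0 (c : k), [/\ Z z0, c != 0 & B (z0 - c%:MP *: v n)]).
  exists (fun t => if (t < n)%N then w t else z0) => [t|z /hw[e [a ha]]].
    by case: ifP.
  exists (fun t => if (t < n)%N then e t else a / c).
  rewrite big_ord_recr /= ltnn opprD addrA.
  rewrite (sum_if_scale _ e (fun=> a / c) w (fun=> z0)).
  have := ksubB hB ha (ksubZ (a / c) hB hc).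
  rewrite scalerBr scalerA -mpolyCM divfK // opprB addrA.
  by rewrite subrK.
exists w => // z Zz; have [e [a ha]] := hw z Zz.
exists (fun t => if (t < n)%N then e t else 0).
rewrite big_ord_recr /= ltnn mpolyC0 scale0r addr0.
have -> : \sum_(t < n) (if (t < n)%N then e t else 0)%:MP *: w t =
    \sum_(t < n) (e t)%:MP *: w t by apply: eq_bigr => t _; rewrite ltn_ord.
have [a0|a0] := eqVneq a 0; first by move: ha; rewrite a0 mpolyC0 scale0r subr0.
case: no; exists (z - \sum_(t < n) (e t)%:MP *: w t), a; split=> //.
by apply: ksubB => //; apply: ksub_sum => // t _; apply: ksubZ.
Qed.

(** Half of the additivity of dimension. The vectors of a spanning set of Z modulo
    B, taken in Z, are treated one by one, enlarging B and W by each: a vector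
    counts for W / B if it lies in the current W, and for Z / W otherwise. *)
Lemma dimle_split Z W B n : ksub Z -> ksub W -> ksub B ->
  (forall z, B z -> W z) -> (forall z, W z -> Z z) -> dimle Z B n ->
  exists p q, [/\ (p + q <= n)%N, dimle Z W p & dimle W B q].
Proof.
move=> hZ; elim: n W B => [|n IH] W B hW hB BW WZ.
  move=> /dimle0P h; exists 0%N, 0%N; split=> //; apply: dimle0 => // z.
    by move=> /h /BW.
  by move=> /WZ /h.
move=> /(dimle_in hZ hB)[v Zv h].
pose add (X : set V) : set V := [set u | exists c : k, X (u - c%:MP *: v n)].
have hadd X : ksub X -> ksub (add X).
  move=> hX; split; first by exists 0; rewrite mpolyC0 scale0r subr0; exact: ksub0.
  move=> c x y [a ha] [b hb]; exists (c * a + b).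
  rewrite mpolyCD mpolyCM scalerDl -scalerA opprD addrACA -scalerBr.
  by case: hX => _; apply.
have hZ1 : dimle Z (add B) n.
  exists v => z /h[c]; rewrite big_ord_recr /= opprD addrA => hc.
  by exists c, (c n).
have BadW z : add B z -> add W z by case=> c /BW; exists c.
have adZ z : add W z -> Z z.
  by case=> c /WZ hc; rewrite -(subrK (c%:MP *: v n) z); apply: ksubD => //; apply: ksubZ.
have [p [q [pq d1 d2]]] := IH _ _ (hadd _ hW) (hadd _ hB) BadW adZ hZ1.
have [Wv|nWv] := pselect (W (v n)).
  exists p, q.+1; split; first by rewrite addnS.
    apply: dimle_sub d1 => // z [c hc].
    by rewrite -(subrK (c%:MP *: v n) z); apply: ksubD => //; apply: ksubZ.
  apply: (@dimleS _ _ _ (v n)); apply: dimle_sub d2 => // z Wz; exists 0.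
  by rewrite mpolyC0 scale0r subr0.
exists p.+1, q; split=> //; first exact: (@dimleS _ _ _ (v n)).
have W1 z : W z -> add W z by move=> Wz; exists 0; rewrite mpolyC0 scale0r subr0.
have [w Ww hw] := dimle_in hW (hadd _ hB) (dimle_sub W1 (fun _ h => h) d2).
exists w => z Wz; have [c [e he]] := hw z Wz; exists c.
suff e0 : e = 0 by move: he; rewrite e0 mpolyC0 scale0r subr0.
apply: contra_notP nWv => /eqP e0.
have hd : W (e%:MP *: v n).
  rewrite -[X in W X](subKr (z - \sum_(t < q) (c t)%:MP *: w t)).
  apply: ksubB => //; last exact: BW.
  by apply: ksubB => //; apply: ksub_sum => // t _; apply: ksubZ.
by have := ksubZ e^-1 hW hd; rewrite scalerA -mpolyCM mulVf // scale1r.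
Qed.

Definition kdim Z B : nat :=
  if pselect (exists n, `[<dimle Z B n>]) is left h then ex_minn h else 0.

Lemma kdim_le Z B n : dimle Z B n -> (kdim Z B <= n)%N.
Proof.
move=> h; rewrite /kdim; case: pselect => // h'.
by case: ex_minnP => m _; apply; apply/asboolP.
Qed.

Lemma kdimP Z B n : dimle Z B n -> dimle Z B (kdim Z B).
Proof.
move=> h; rewrite /kdim; case: pselect => [h'|[]].
  by case: ex_minnP => m /asboolP.
by exists n; apply/asboolP.
Qed.

Lemma kdim_split Z W B n : ksub Z -> ksub W -> ksub B ->
  (forall z, B z -> W z) -> (forall z, W z -> Z z) -> dimle Z B n ->
  (kdim Z W + kdim W B <= kdim Z B)%N.
Proof.
move=> hZ hW hB BW WZ /kdimP h.
have [p [q [pq d1 d2]]] := dimle_split hZ hW hB BW WZ h.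
by apply: leq_trans pq; apply: leq_add; apply: kdim_le.
Qed.

End OneModule.

(** Additivity of dimension along a linear relation. When rho is the graph of a
    map Z -> Z', this bounds dim Z/B by dim Z'/B' plus the dimension of the
    kernel; connecting homomorphisms, defined only up to choices, are
    relations of this kind. *)
Lemma dimle_rel (V W : lmodType R) (Z B : set V) (Z' B' : set W)
    (rho : V -> W -> Prop) p q :
  ksub Z -> ksub B -> ksub Z' -> ksub B' -> rho 0 0 ->
  (forall (c : k) a b a' b', rho a a' -> rho b b' ->
     rho (c%:MP *: a + b) (c%:MP *: a' + b')) ->
  (forall z, Z z -> exists2 w, Z' w & rho z w) -> dimle Z' B' p ->
  dimle [set z | Z z /\ exists2 w, B' w & rho z w] B q -> dimle Z B (p + q).
Proof.
move=> hZ hB hZ' hB' rho0 rhoL tot d1 [v2 h2].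
pose T : set W := [set w | Z' w /\ exists2 z, Z z & rho z w].
have hT : ksub T.
  split; first by split; [exact: ksub0|exists 0 => //; exact: ksub0].
  move=> c a b [Za [x Zx ra]] [Zb [y Zy rb]]; split; first by case: hZ' => _; apply.
  by exists (c%:MP *: x + y); [case: hZ => _; apply|apply: rhoL].
have /(dimle_in hT hB')[w Tw hw] : dimle T B' p by apply: dimle_sub d1 => // z [].
have /choice[u hu] : forall t, exists z, Z z /\ rho z (w t).
  by move=> t; have [_ [z Zz rz]] := Tw t; exists z.
exists (fun t => if (t < p)%N then u t else v2 (t - p)%N) => z Zz.
have [w0 Zw0 rw0] := tot z Zz.
have [|c hc] := hw w0; first by split=> //; exists z.
have rhoS n : rho (\sum_(t < n) (c t)%:MP *: u t) (\sum_(t < n) (c t)%:MP *: w t).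
  elim: n => [|n IH]; first by rewrite !big_ord0.
  by rewrite !big_ord_recr /= addrC [X in rho _ X]addrC; apply: rhoL => //; case: (hu n).
have [|e he] := h2 (z - \sum_(t < p) (c t)%:MP *: u t).
  split; first by apply: ksubB => //; apply: ksub_sum => // t _; apply: ksubZ => //; case: (hu t).
  exists (w0 - \sum_(t < p) (c t)%:MP *: w t) => //.
  have := rhoL (-1) _ _ _ _ (rhoS p) rw0.
  by rewrite !mpolyCN !scaleN1r ![- _ + _]addrC.
exists (fun t => if (t < p)%N then c t else e (t - p)%N).
rewrite big_split_ord /= opprD addrA.
rewrite (sum_if_scale _ c (fun t => e (t - p)%N) u (fun t => v2 (t - p)%N)).
have -> // : \sum_(t < q) (if (p + t < p)%N then c (p + t)%N else e (p + t - p)%N)%:MP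
    *: (if (p + t < p)%N then u (p + t)%N else v2 (p + t - p)%N) =
  \sum_(t < q) (e t)%:MP *: v2 t.
by apply: eq_bigr => t _; rewrite ltnNge leq_addr /= addKn.
Qed.

Lemma dimle_rel0 (V W : lmodType R) (Z B : set V) (Z' B' : set W)
    (rho : V -> W -> Prop) p :
  ksub Z -> ksub B -> ksub Z' -> ksub B' -> rho 0 0 ->
  (forall (c : k) a b a' b', rho a a' -> rho b b' ->
     rho (c%:MP *: a + b) (c%:MP *: a' + b')) ->
  (forall z, Z z -> exists2 w, Z' w & rho z w) ->
  (forall z w, Z z -> B' w -> rho z w -> B z) -> dimle Z' B' p -> dimle Z B p.
Proof.
move=> hZ hB hZ' hB' r0 rL tot inj d1; rewrite -(addn0 p).
apply: (dimle_rel hZ hB hZ' hB' r0 rL tot d1).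
by apply: dimle0 => z [Zz [w B'w /inj]]; apply.
Qed.

End SpanModulo.

(** * Cech cochains with common denominators *)

Section GradedCech.
Local Open Scope classical_set_scope.
Local Open Scope ring_scope.
Variables (k : fieldType) (d : nat).
Local Notation R := {mpoly k[d]}.
Variable M : lmodType R.
Implicit Types (K L H : int -> set M) (S T : {set 'I_d}) (j : int).

(** A graded submodule, given by its pieces. They need not be independent nor
    come from a grading of M: localizing and comparing pieces only uses the
    action of the variables. *)
Definition gsub K : Prop :=
  (forall j, ksub (K j)) /\ forall j (l : 'I_d) m, K j m -> K (j + 1) ('X_l *: m).

Lemma gsub_ksub K j : gsub K -> ksub (K j). Proof. by case. Qed.

Lemma gsub_varexp K j l e m : gsub K -> K j m -> K (j + e%:Z) ('X_l ^+ e *: m).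
Proof.
move=> hK Km; elim: e => [|e IH]; first by rewrite addr0 expr0 scale1r.
rewrite exprS -scalerA intS (addrC 1) addrA.
by case: hK => _; apply.
Qed.

Lemma gsub_varprod K j S m : gsub K -> K j m ->
  K (j + #|S|%:Z) (varprod k S *: m).
Proof.
move=> hK Km; rewrite /varprod -big_enum /= cardE.
elim: (enum S) => [|l s IH] /=; first by rewrite big_nil addr0 scale1r.
rewrite big_cons -scalerA intS (addrC 1) addrA.
by case: hK => _; apply.
Qed.

Lemma gsub_varprodX K j S e m : gsub K -> K j m ->
  K (j + (e * #|S|)%N%:Z) (varprod k S ^+ e *: m).
Proof.
move=> hK Km; elim: e => [|e IH]; first by rewrite mul0n addr0 expr0 scale1r.
rewrite exprS -scalerA mulSn addnC PoszD addrA.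
exact: gsub_varprod.
Qed.

Lemma ksub_sign (B : set M) n u : ksub B -> B u -> B ((-1 : R) ^+ n *: u).
Proof.
move=> hB Bu; elim: n => [|n IH]; first by rewrite expr0 scale1r.
by rewrite exprS -scalerA scaleN1r; apply: ksubN.
Qed.

Lemma frac_expand (f : R) e (m : M) a : Defs.frac f (f ^+ e *: m) (a + e) = Defs.frac f m a.
Proof. by apply/fracP; exists 0%N; rewrite scalerA -exprD. Qed.

Lemma frac0 (f : R) a : Defs.frac f (0 : M) a = 0.
Proof.
transitivity (Defs.frac f (0 : M) 0); last by [].
by apply/fracP; exists 0%N; rewrite !scaler0.
Qed.

(** The cochain with numerators m and common denominators 'X_S ^ a. Since there
    are finitely many S, every cochain has this form; on such cochains the Cech
    differential is that of the Koszul complex on the powers 'X_j ^ a. *)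
Definition fam (a : nat) (m : {set 'I_d} -> M) : cech M :=
  fun S => Defs.frac (varprod k S) (m S) a.

Lemma fam_expand a e m : fam (a + e) (fun S => varprod k S ^+ e *: m S) = fam a m.
Proof. by apply: functional_extensionality_dep => S; rewrite /fam frac_expand. Qed.

Lemma fam_linear a (r : R) m n :
  r *: fam a m + fam a n = fam a (fun S => r *: m S + n S).
Proof.
apply: functional_extensionality_dep => S; rewrite /fam fracDl -fracZ.
by [].
Qed.

Lemma fam_scale a (r : R) m : r *: fam a m = fam a (fun S => r *: m S).
Proof.
by apply: functional_extensionality_dep => S; rewrite /fam -fracZ.
Qed.

Lemma fam_add a m n : fam a m + fam a n = fam a (fun S => m S + n S).
Proof. by apply: functional_extensionality_dep => S; rewrite /fam fracDl. Qed.

Lemma fam_piece K j a m : (forall S, K (j + (a * #|S|)%N%:Z) (m S)) ->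
  cech_piece K j (fam a m).
Proof. by move=> h S; exists (m S), a. Qed.

Lemma cech_pieceP K j c : gsub K -> cech_piece K j c ->
  exists A, forall a, (A <= a)%N ->
    exists2 m, c = fam a m & forall S, K (j + (a * #|S|)%N%:Z) (m S).
Proof.
move=> hK /choice[m /choice[b h]]; exists (\max_S b S)%N => a le_a.
have le_b S : (b S <= a)%N by apply: leq_trans le_a; apply: leq_bigmax.
exists (fun S => varprod k S ^+ (a - b S) *: m S) => [|S]; last first.
  have [h1 _] := h S; have := gsub_varprodX S (a - b S) hK h1.
  by rewrite -addrA -PoszD -mulnDl subnKC.
apply: functional_extensionality_dep => S; have [_ ->] := h S.
by have := frac_expand (varprod k S) (a - b S) (m S) (b S); rewrite subnKC.
Qed.

(** Membership of fractions in a localization becomes membership of numerators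
    after multiplying numerators and denominators by a large power. *)
Lemma fam_pieceP L j a m : gsub L -> cech_piece L j (fam a m) ->
  exists e, forall S, L (j + ((a + e) * #|S|)%N%:Z) (varprod k S ^+ e *: m S).
Proof.
move=> hL h.
have /choice[b hb] S : exists e, L (j + ((a + e) * #|S|)%N%:Z) (varprod k S ^+ e *: m S).
  have [l [b [Ll /fracP[c hc]]]] := h S; exists (c + b)%N; rewrite hc.
  have := gsub_varprodX S (c + a) hL Ll.
  by rewrite -addrA -PoszD -mulnDl; have -> : (b + (c + a) = a + (c + b))%N by lia.
exists (\max_S b S)%N => S.
have le_b : (b S <= \max_S b S)%N by apply: leq_bigmax.
have := gsub_varprodX S (\max_S b S - b S) hL (hb S).
by rewrite scalerA -exprD subnK // -addrA -PoszD -mulnDl -addnA subnKC.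
Qed.

Lemma cech_fam c : exists a m, c = fam a m.
Proof.
have [] := @cech_pieceP (fun _ => setT) 0 c.
- by split=> // j; split.
- by move=> S; have [m [a ->]] := frac_surj (c S); exists m, a.
- by move=> A /(_ A (leqnn _)) [m]; exists A, m.
Qed.

Lemma cech_piece_ksub K j : gsub K -> ksub (cech_piece K j).
Proof.
move=> hK; split.
  move=> S; exists 0, 0%N; split; last by [].
  by apply: ksub0; exact: gsub_ksub.
move=> c u v /(cech_pieceP hK)[A hA] /(cech_pieceP hK)[A' hA'].
have [m -> hm] := hA _ (leq_maxl A A'); have [n -> hn] := hA' _ (leq_maxr A A').
rewrite fam_linear; apply: fam_piece => S.
by case: (gsub_ksub (j + (maxn A A' * #|S|)%N%:Z) hK) => _; apply.
Qed.

Lemma cech_piece_sub K L j j' c : j = j' -> (forall i m, K i m -> L i m) ->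
  cech_piece K j c -> cech_piece L j' c.
Proof. by move=> <- KL h S; have [m [a [/KL Lm ->]]] := h S; exists m, a. Qed.

Definition sgn (l : 'I_d) S : R := (-1) ^+ #|[set i in S | (i < l)%N]|.

Lemma sgn_setD1 (l i : 'I_d) S : i \in S ->
  sgn l S = sgn l (S :\ i) * (-1) ^+ (i < l)%N.
Proof.
move=> iS; rewrite /sgn -exprD; congr (_ ^+ _).
rewrite (cardsD1 i) inE iS addnC /=; congr (_ + _)%N.
by apply: eq_card => x; rewrite !inE andbA.
Qed.

Lemma sgn_swap (l i : 'I_d) S : i \in S -> l \in S -> i != l ->
  sgn l S * sgn i (S :\ l) = - (sgn i S * sgn l (S :\ i)).
Proof.
move=> iS lS il; rewrite (sgn_setD1 l iS) (sgn_setD1 i lS).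
have := il; rewrite -val_eqE /=; case: ltngtP => //= _ _.
  by rewrite expr1 expr0; ring.
by rewrite expr1 expr0; ring.
Qed.

Lemma sgn_sqr l S : sgn l S * sgn l S = 1.
Proof. by rewrite -expr2 sqrr_sign. Qed.

Definition koszul a (m : {set 'I_d} -> M) S : M :=
  \sum_(l in S) sgn l S *: ('X_l ^+ a *: m (S :\ l)).

Lemma cech_diff_fam a m : cech_diff (fam a m) = fam a (koszul a m).
Proof.
apply: functional_extensionality_dep => S; rewrite /cech_diff /fam /koszul.
rewrite (big_morph (fun x => Defs.frac (varprod k S) x a)
  (fun x y => fracDl (varprod k S) x y a) (frac0 _ a)).
by apply: eq_bigr => l lS; rewrite (loc_mapE (varprodD1 k lS)) fracZ.
Qed.

Lemma koszul_piece K j a m : gsub K ->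
  (forall S, K (j + (a * #|S|)%N%:Z) (m S)) ->
  forall S, K (j + (a * #|S|)%N%:Z) (koszul a m S).
Proof.
move=> hK h S; have hKj := gsub_ksub (j + (a * #|S|)%N%:Z) hK.
apply: ksub_sum => // l lS; apply: ksub_sign => //.
have := gsub_varexp l a hK (h (S :\ l)).
by rewrite -addrA -PoszD (cardsD1 l S) lS mulnDr muln1 addnC.
Qed.

(** The terms indexed by (l, i) and (i, l) cancel; they are paired explicitly
    since 2 may vanish in k. *)
Lemma koszul_kos a m S : koszul a (koszul a m) S = 0.
Proof.
pose F (l i : 'I_d) : M := sgn l S * sgn i (S :\ l) * ('X_l ^+ a * 'X_i ^+ a)
  *: m (S :\ l :\ i).
have -> : koszul a (koszul a m) S = \sum_(l in S) \sum_(i in S :\ l) F l i.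
  apply: eq_bigr => l lS; rewrite /koszul !scaler_sumr; apply: eq_bigr => i _.
  by rewrite !scalerA /F; congr (_ *: _); ring.
have -> : \sum_(l in S) \sum_(i in S :\ l) F l i =
    \sum_(l in S) \sum_(i in S | (i < l)%N) F l i
    + \sum_(l in S) \sum_(i in S | (l < i)%N) F l i.
  rewrite -big_split; apply: eq_bigr => l lS /=.
  rewrite (bigID (fun i : 'I_d => (i < l)%N)) /=; congr (_ + _); apply: eq_bigl => i;
    rewrite !inE -val_eqE /=; case: (ltngtP i l) => //=; rewrite ?andbT ?andbF //.
rewrite [X in _ + X](exchange_big_dep (fun i => i \in S)) /=; last by move=> ? ? _ /andP[].
rewrite -big_split big1 // => l lS /=.
have -> : \sum_(i in S | (l \in S) && (i < l)%N) F i l =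
    \sum_(i in S | (i < l)%N) - F l i.
  rewrite (eq_bigl (fun i => (i \in S) && (i < l)%N)); last first.
    by move=> i; rewrite lS.
  apply: eq_bigr => i /andP[iS il]; rewrite /F -scaleNr; congr (_ *: m _).
    have -> := sgn_swap lS iS; first by ring.
    by rewrite neq_ltn il orbT.
  by apply/setP => x; rewrite !inE; case: (x == i); case: (x == l).
by rewrite sumrN subrr.
Qed.

Lemma cech_diffK (c : cech M) : cech_diff (cech_diff c) = 0.
Proof.
have [a [m ->]] := cech_fam c; rewrite !cech_diff_fam.
by apply: functional_extensionality_dep => S; rewrite /fam koszul_kos frac0.
Qed.

(** Contraction against the l-th basis vector of the Koszul complex on the powers
    'X_j ^+ a: a homotopy between multiplication by 'X_l ^+ a and 0. *)
Definition htpy l (m : {set 'I_d} -> M) S : M :=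
  if l \in S then 0 else sgn l (l |: S) *: m (l |: S).

Lemma koszul_htpy a l m S :
  koszul a (htpy l m) S + htpy l (koszul a m) S = 'X_l ^+ a *: m S.
Proof.
rewrite /htpy; case: ifP => lS.
  rewrite addr0 /koszul (bigD1 l) //= finset.setD11 finset.setD1K // big1 => [|i /andP[iS il]].
    by rewrite addr0 !scalerA mulrAC sgn_sqr mul1r.
  by rewrite !inE eq_sym il lS !scaler0.
have lnS : l \notin S by rewrite lS.
rewrite /koszul (big_setU1 _ lnS) /= finset.setU1K // scalerDr addrCA.
rewrite scalerA sgn_sqr scale1r scaler_sumr -big_split big1 ?addr0 // => i iS /=.
have il : i != l by apply: contraNneq lnS => <-.
rewrite !inE eq_sym (negbTE il) /= (negbTE lnS).
have -> : l |: (S :\ i) = (l |: S) :\ i.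
  by apply/setP => x; rewrite !inE; have [->|] := eqVneq x l; rewrite //= eq_sym il.
have lT : l \in l |: S by rewrite !inE eqxx.
have iT : i \in l |: S by rewrite !inE iS orbT.
rewrite (sgn_setD1 i lT) (sgn_setD1 l iT) finset.setU1K // !scalerA -scalerDl.
set u := sgn _ _; set v := sgn _ _; set x := _ ^+ a.
have -> : (-1 : R) ^+ (l < i)%N = - (-1) ^+ (i < l)%N.
  by move: il; rewrite -val_eqE /=; case: ltngtP => // _ _; rewrite ?opprK.
have sq : (-1 : R) ^+ (i < l)%N * (-1) ^+ (i < l)%N = 1.
  by rewrite -expr2 sqrr_sign.
set e := (-1) ^+ _ in sq *.
have -> : u * x * v + v * e * (u * - e) * x = u * x * v * (1 - e * e) by ring.
by rewrite sq subrr mulr0 scale0r.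
Qed.

End GradedCech.

(** * Cohomology of graded subquotients *)

Section RelativeCohomology.
Local Open Scope classical_set_scope.
Local Open Scope ring_scope.
Variables (k : fieldType) (d : nat).
Local Notation R := {mpoly k[d]}.
Variable M : lmodType R.
Implicit Types (K L H : int -> set M) (j : int) (c z : cech M).

Lemma cech_diffD c z : cech_diff (c + z) = cech_diff c + cech_diff z.
Proof. by have := cech_diff_linear 1 c z; rewrite !scale1r. Qed.

Lemma cech_diff0 : cech_diff (0 : cech M) = 0.
Proof. by apply: (addrI (cech_diff 0)); rewrite -cech_diffD !addr0. Qed.

Lemma cech_diffZ (r : R) c : cech_diff (r *: c) = r *: cech_diff c.
Proof. by have := cech_diff_linear r c 0; rewrite cech_diff0 !addr0. Qed.

Lemma cech_diffB c z : cech_diff (c - z) = cech_diff c - cech_diff z.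
Proof. by rewrite cech_diffD -scaleN1r cech_diffZ scaleN1r. Qed.

Lemma cech_piece_diff K j c : gsub K -> cech_piece K j c ->
  cech_piece K j (cech_diff c).
Proof.
move=> hK /(cech_pieceP hK)[a /(_ _ (leqnn _))[m -> hm]].
by rewrite cech_diff_fam; apply: fam_piece; apply: koszul_piece.
Qed.

Lemma cech_piece_X K j l c : gsub K -> cech_piece K j c ->
  cech_piece K (j + 1) ('X_l *: c).
Proof.
move=> hK h S; have [m [a [Km cS]]] := h S; exists ('X_l *: m), a; split.
  by rewrite addrAC; case: hK => _; apply.
by rewrite -fracZ -cS.
Qed.

(** Since localization is exact, cochains of K / L are represented by cochains of
    K, and all subquotients of M share one ambient complex. All cohomological
    indices are treated at once: [cocyc K L j] modulo [cobnd K L j] is the total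
    cohomology of K / L in degree j, which makes indices disappear from the long
    exact sequences below. *)
Definition cocyc K L j : set (cech M) :=
  [set z | cech_piece K j z /\ cech_piece L j (cech_diff z)].

Definition cobnd K L j : set (cech M) :=
  [set z | exists b l, [/\ cech_piece K j b, cech_piece L j l
                         & z = cech_diff b + l]].

Definition coh_dimle K L j n : Prop := dimle (cocyc K L j) (cobnd K L j) n.

Lemma cocyc_ksub K L j : gsub K -> gsub L -> ksub (cocyc K L j).
Proof.
move=> /(cech_piece_ksub j) hK /(cech_piece_ksub j) hL; split.
  by split; [exact: ksub0|rewrite cech_diff0; exact: ksub0].
move=> c u v [Ku Lu] [Kv Lv]; split; first by case: hK => _; apply.
by rewrite cech_diff_linear; case: hL => _; apply.
Qed.

Lemma cobnd_ksub K L j : gsub K -> gsub L -> ksub (cobnd K L j).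
Proof.
move=> /(cech_piece_ksub j) hK /(cech_piece_ksub j) hL; split.
  by exists 0, 0; split; [exact: ksub0..|rewrite cech_diff0 addr0].
move=> c u v [b [l [Kb Ll ->]]] [b' [l' [Kb' Ll' ->]]].
exists (c%:MP *: b + b'), (c%:MP *: l + l').
split; first by case: hK => _; apply.
  by case: hL => _; apply.
by rewrite cech_diff_linear scalerDr addrACA.
Qed.

Lemma cobnd_sub K L j z : cech_piece L j z -> gsub K -> cobnd K L j z.
Proof.
move=> Lz hK; exists 0, z; split=> //; last by rewrite cech_diff0 add0r.
by apply: ksub0; exact: cech_piece_ksub.
Qed.

(** Exactness of the cohomology sequence of K/L -> H/L -> H/K at its middle. *)
Lemma coh_ext K L H j p q : gsub K -> gsub L -> gsub H ->
  (forall i m, L i m -> K i m) -> (forall i m, K i m -> H i m) ->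
  coh_dimle H K j p -> coh_dimle K L j q -> coh_dimle H L j (p + q).
Proof.
move=> hK hL hH LK KH dHK dKL.
have cK := cech_piece_ksub j hK; have cL := cech_piece_ksub j hL.
have cH := cech_piece_ksub j hH.
have LKc c : cech_piece L j c -> cech_piece K j c by exact: cech_piece_sub.
have KHc c : cech_piece K j c -> cech_piece H j c by exact: cech_piece_sub.
apply: (dimle_rel (rho := eq) (cocyc_ksub j hH hL) (cobnd_ksub j hH hL)
  (cocyc_ksub j hH hK) (cobnd_ksub j hH hK) _ _ _ dHK) => //.
- by move=> c a b a' b' -> ->.
- by move=> z [Hz Lz]; exists z => //; split=> //; apply: LKc.
pose rho z y := exists2 b, cech_piece H j b & z = cech_diff b + y.
apply: (dimle_rel0 (rho := rho) _ (cobnd_ksub j hH hL)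
  (cocyc_ksub j hK hL) (cobnd_ksub j hK hL) _ _ _ _ dKL).
- have hZ := cocyc_ksub j hH hL; have hB := cobnd_ksub j hH hK.
  split; first by split; [exact: ksub0|exists 0 => //; exact: ksub0].
  move=> c u v [Zu [u' Bu uE]] [Zv [v' Bv vE]]; subst u' v'.
  split; first by case: hZ => _; apply.
  by exists (c%:MP *: u + v) => //; case: hB => _; apply.
- by exists 0; [exact: ksub0|rewrite cech_diff0 addr0].
- move=> c u v u' v' [b Hb ->] [b' Hb' ->]; exists (c%:MP *: b + b').
    by case: cH => _; apply.
  by rewrite cech_diff_linear scalerDr addrACA.
- move=> z [[Hz Lz] [_ [b [l [Hb Kl ->]]] zE]]; exists l; last by exists b.
  split=> //; move: Lz; rewrite zE cech_diffD cech_diffK add0r //.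
- move=> z w _ [b [l [Kb Ll ->]]] [b' Hb' ->]; exists (b' + b), l; split=> //.
    by apply: (ksubD cH) => //; apply: KHc.
  by rewrite cech_diffD addrA.
Qed.

Section Multiplication.
Variable l : 'I_d.

(** The colon (L : 'X_l) in K, and L + 'X_l K. *)
Definition colonX K L j : set M := [set m | K j m /\ L (j + 1) ('X_l *: m)].
Definition addX K L j : set M :=
  [set m | exists u v, [/\ L j u, K (j - 1) v & m = u + 'X_l *: v]].

Lemma colonX_gsub K L : gsub K -> gsub L -> gsub (colonX K L).
Proof.
move=> [hK hK'] [hL hL']; split=> [j|j i m [Km Lm]]; last first.
  by split; [exact: hK'|rewrite scale_swap; exact: hL'].
split; first by split; [exact: ksub0|rewrite scaler0; exact: ksub0].
move=> c u v [Ku Lu] [Kv Lv]; split; first by case: (hK j) => _; apply.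
by rewrite scalerDr scale_swap; case: (hL (j + 1)) => _; apply.
Qed.

Lemma addX_gsub K L : gsub K -> gsub L -> gsub (addX K L).
Proof.
move=> [hK hK'] [hL hL']; split=> [j|j i _ [u [v [Lu Kv ->]]]]; last first.
  exists ('X_i *: u), ('X_i *: v); split; first exact: hL'.
    by rewrite addrAC; exact: hK'.
  by rewrite scalerDr (scale_swap 'X_i).
split; first by exists 0, 0; split; [exact: ksub0..|rewrite scaler0 addr0].
move=> c _ _ [u [v [Lu Kv ->]]] [u' [v' [Lu' Kv' ->]]].
exists (c%:MP *: u + u'), (c%:MP *: v + v').
split; first by case: (hL j) => _; apply.
  by case: (hK (j - 1)) => _; apply.
by rewrite !scalerDr addrACA (scale_swap _ 'X_l).
Qed.

Lemma sub_addX K L j m : gsub K -> L j m -> addX K L j m.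
Proof.
move=> [hK _] Lm; exists m, 0; split=> //; first exact: ksub0.
by rewrite scaler0 addr0.
Qed.

Lemma addX_sub K L j m : gsub K -> (forall i n, L i n -> K i n) ->
  addX K L j m -> K j m.
Proof.
move=> [hK hK'] LK [u [v [/LK Lu Kv ->]]]; apply: ksubD => //.
by rewrite -(subrK 1 j); apply: hK'.
Qed.

Lemma cech_piece_colonX K L j c : gsub K -> gsub L ->
  cech_piece K j c -> cech_piece L (j + 1) ('X_l *: c) ->
  cech_piece (colonX K L) j c.
Proof.
move=> hK hL /(cech_pieceP hK)[a /(_ _ (leqnn _))[m -> hm]].
rewrite fam_scale => /(fam_pieceP hL)[e he].
rewrite -(fam_expand a e); apply: fam_piece => S; split.
  have := gsub_varprodX S e hK (hm S).
  by rewrite -addrA -PoszD -mulnDl.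
by have := he S; rewrite scale_swap addrAC.
Qed.

Lemma cech_piece_addX K L j c : gsub K -> gsub L -> cech_piece (addX K L) j c ->
  exists u v, [/\ cech_piece L j u, cech_piece K (j - 1) v & c = u + 'X_l *: v].
Proof.
move=> hK hL /(cech_pieceP (addX_gsub hK hL))[a /(_ _ (leqnn _))[m -> hm]].
have /choice[u /choice[v h]] := hm.
exists (fam a u), (fam a v); split.
- by apply: fam_piece => S; case: (h S).
- by apply: fam_piece => S; rewrite addrAC; case: (h S).
- rewrite fam_scale fam_add; congr fam; apply: functional_extensionality_dep => S.
  by case: (h S).
Qed.

Lemma cech_addX_X K L j c : gsub L -> cech_piece K (j - 1) c ->
  cech_piece (addX K L) j ('X_l *: c).
Proof.
move=> [hL _] h S; have [m [a [Km cS]]] := h S; exists ('X_l *: m), a; split.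
  exists 0, m; split; [exact: ksub0|by rewrite addrAC|by rewrite add0r].
by rewrite -fracZ -cS.
Qed.

(** Multiplication by 'X_l identifies K/(L : 'X_l) with (L + 'X_l K)/L. *)
Lemma coh_addX K L j p : gsub K -> gsub L ->
  coh_dimle K (colonX K L) (j - 1) p -> coh_dimle (addX K L) L j p.
Proof.
move=> hK hL dK; have hC := colonX_gsub hK hL; have hA := addX_gsub hK hL.
have cL := cech_piece_ksub j hL; have cK := cech_piece_ksub (j - 1) hK.
pose rho z y := cech_piece K (j - 1) y /\ cech_piece L j (z - 'X_l *: y).
apply: (dimle_rel0 (rho := rho) (cocyc_ksub j hA hL) (cobnd_ksub j hA hL)
  (cocyc_ksub _ hK hC) (cobnd_ksub _ hK hC) _ _ _ _ dK).
- by split; [exact: ksub0|rewrite scaler0 subr0; exact: ksub0].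
- move=> c u v u' v' [Ku' Lu] [Kv' Lv]; split; first by case: cK => _; apply.
  rewrite scalerDr opprD addrACA scale_swap -scalerBr.
  by case: cL => _; apply.
- move=> z [Az Lz]; have [u [v [Lu Kv zE]]] := cech_piece_addX hK hL Az.
  exists v; last by split=> //; rewrite zE addrK.
  split=> //; apply: cech_piece_colonX => //; first exact: cech_piece_diff.
  rewrite subrK -cech_diffZ -[X in cech_diff X](addKr u) -zE addrC cech_diffB.
  by apply: (ksubB cL) => //; apply: cech_piece_diff.
- move=> z w _ [b [y [Kb Cy ->]]] [_ Lz].
  exists ('X_l *: b), ('X_l *: y + (z - 'X_l *: (cech_diff b + y))); split.
  + exact: cech_addX_X.
  + apply: (ksubD cL) => //.
    by move=> S; have [m [a [[_ Lm] yS]]] := Cy S; exists ('X_l *: m), a;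
      split; [move: Lm; rewrite addrAC subrK|rewrite -fracZ -yS].
  + by rewrite addrA cech_diffZ -scalerDr addrC subrK.
Qed.

Section Injective.
Variables K L : int -> set M.
Hypotheses (hK : gsub K) (hL : gsub L).
Hypothesis inj : forall j m, K j m -> L (j + 1) ('X_l *: m) -> L j m.

(* The connecting map, inverted and seen as a relation: z in degree j is related
   to every b with 'X_l z = d b modulo L. *)
Let conn j z b := cech_piece K (j + 1) b /\
  cech_piece L (j + 1) ('X_l *: z - cech_diff b).

Lemma conn_cobnd j z b : cocyc K L j z -> conn j z b ->
  cobnd K (addX K L) (j + 1) b -> cobnd K L j z.
Proof.
move=> [Kz _] [_ Lzb] [c [y [Kc /(cech_piece_addX hK hL)[u [v [Lu Kv yE]]] bE]]].
rewrite addrK in Kv.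
have cL := cech_piece_ksub (j + 1) hL.
have h : cech_piece L (j + 1) ('X_l *: (z - cech_diff v)).
  have -> : 'X_l *: (z - cech_diff v) = ('X_l *: z - cech_diff b) + cech_diff u.
    rewrite bE yE !cech_diffD cech_diffK add0r cech_diffZ scalerBr.
    by rewrite opprD addrA [RHS]addrAC subrK.
  by apply: (ksubD cL) => //; apply: cech_piece_diff.
have hd : cech_piece K j (z - cech_diff v).
  by apply: (ksubB (cech_piece_ksub j hK)) => //; exact: cech_piece_diff.
exists v, (z - cech_diff v); split=> //; last by rewrite addrC subrK.
apply: cech_piece_sub (cech_piece_colonX hK hL hd h) => // i m [Km Lm].
exact: inj.
Qed.

Lemma conn_total j z : cocyc K L j z -> cobnd K L (j + 1) ('X_l *: z) ->
  exists2 b, cocyc K (addX K L) (j + 1) b & conn j z b.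
Proof.
move=> [Kz Lz] [b [y [Kb Ly zE]]]; exists b; last first.
  by split=> //; rewrite zE addrAC subrr add0r.
split=> //; have -> : cech_diff b = 'X_l *: z - y by rewrite zE addrK.
apply: (ksubB (cech_piece_ksub (j + 1) (addX_gsub hK hL))).
  by apply: cech_addX_X => //; rewrite addrK.
by apply: cech_piece_sub Ly => // i m; apply: sub_addX.
Qed.

Lemma conn_linear j (c : k) z b z' b' : conn j z b -> conn j z' b' ->
  conn j (c%:MP *: z + z') (c%:MP *: b + b').
Proof.
move=> [Kb Lb] [Kb' Lb']; split.
  by case: (cech_piece_ksub (j + 1) hK) => _; apply.
rewrite cech_diff_linear scalerDr opprD addrACA (scale_swap 'X_l) -scalerBr.
by case: (cech_piece_ksub (j + 1) hL) => _; apply.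
Qed.

Lemma conn0 j : conn j 0 0.
Proof.
by split; [apply: ksub0; exact: cech_piece_ksub|
  rewrite scaler0 cech_diff0 subr0; apply: ksub0; exact: cech_piece_ksub].
Qed.

(** Exactness, at its first term, of the cohomology sequence of
    0 -> (K/L)(-1) -> K/L -> K/(L + 'X_l K) -> 0: the kernel of 'X_l is covered by
    the connecting map. *)
Lemma coh_step j p q : coh_dimle K L (j + 1) p -> coh_dimle K (addX K L) (j + 1) q ->
  coh_dimle K L j (p + q).
Proof.
move=> dp dq; have hA := addX_gsub hK hL.
have hZ := cocyc_ksub j hK hL; have hB := cobnd_ksub (j + 1) hK hL.
have cL := cech_piece_ksub (j + 1) hL.
apply: (dimle_rel (rho := fun z y => y = 'X_l *: z) hZ
  (cobnd_ksub j hK hL) (cocyc_ksub (j + 1) hK hL) hB _ _ _ dp) => //.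
- by rewrite scaler0.
- by move=> c a b a' b' -> ->; rewrite scalerDr scale_swap.
- move=> z [Kz Lz]; exists ('X_l *: z) => //.
  by split; [|rewrite cech_diffZ]; exact: cech_piece_X.
apply: (dimle_rel0 (rho := conn j) _ (cobnd_ksub j hK hL)
  (cocyc_ksub (j + 1) hK hA) (cobnd_ksub (j + 1) hK hA) (conn0 j) _ _ _ dq).
- split.
    by split; [exact: ksub0|exists 0; [exact: ksub0|rewrite scaler0]].
  move=> c u v [Zu [u' Bu uE]] [Zv [v' Bv vE]]; subst u' v'; split.
    by case: hZ => _; apply.
  exists (c%:MP *: ('X_l *: u) + 'X_l *: v); first by case: hB => _; apply.
  by rewrite scalerDr scale_swap.
- by move=> c z b z' b'; exact: conn_linear.
- by move=> z [Zz [y By yE]]; apply: conn_total => //; rewrite -yE.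
- by move=> z b [Zz _] Bb cb; apply: conn_cobnd cb Bb.
Qed.

(** With numerators over a common denominator, a class comes from the Koszul
    complex on the powers 'X_i ^+ a, on which 'X_l ^+ a is null-homotopic. The
    exponent is enlarged to a + e so that the differential has numerators in L,
    not only fractions: the homotopy changes the localization. *)
Lemma cocyc_nilp j z : cocyc K L j z ->
  exists e : nat, cobnd K L (j + e%:Z) ('X_l ^+ e *: z).
Proof.
move=> [/(cech_pieceP hK)[a /(_ _ (leqnn _))[m -> hm]]].
rewrite cech_diff_fam => /(fam_pieceP hL)[e he].
pose n S := varprod k S ^+ e *: m S; exists (a + e)%N.
have nK (S : {set 'I_d}) : K (j + ((a + e) * #|S|)%N%:Z) (n S).
  by have := gsub_varprodX S e hK (hm S); rewrite -addrA -PoszD -mulnDl.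
have nL (S : {set 'I_d}) : L (j + ((a + e) * #|S|)%N%:Z) (koszul (a + e) n S).
  have -> // : koszul (a + e) n S = varprod k S ^+ e *: koszul a m S.
  rewrite /koszul scaler_sumr; apply: eq_bigr => i iS.
  rewrite (varprodD1 k iS) /n !scalerA; congr (_ *: _).
  by rewrite exprMn exprD; ring.
have htpyP P f : gsub P -> (forall S : {set 'I_d}, P (j + ((a + e) * #|S|)%N%:Z) (f S)) ->
    cech_piece P (j + (a + e)%N%:Z) (fam (a + e) (htpy l f)).
  move=> hP hf; apply: fam_piece => S; rewrite /htpy.
  have hPj := gsub_ksub (j + (a + e)%N%:Z + ((a + e) * #|S|)%N%:Z) hP.
  case: ifP => lS; first exact: ksub0.
  apply: ksub_sign => //; have := hf (l |: S).
  by rewrite cardsU1 lS /= mulnDr muln1 PoszD addrA.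
exists (fam (a + e) (htpy l n)), (fam (a + e) (htpy l (koszul (a + e) n))).
split; [exact: htpyP|exact: htpyP|].
rewrite -(fam_expand a e m) fam_scale cech_diff_fam fam_add; congr fam.
by apply: functional_extensionality_dep => S; rewrite koszul_htpy.
Qed.

(** If the third term of the sequence vanishes from degree j + 1 on, then 'X_l is
    injective on the cohomology of K / L from degree j on; being locally
    nilpotent, it forces that cohomology to vanish there. *)
Lemma coh_vanish j : (forall j', j <= j' -> coh_dimle K (addX K L) (j' + 1) 0) ->
  coh_dimle K L j 0.
Proof.
move=> van; apply: dimle0 => z Zz; have [e] := cocyc_nilp Zz.
elim: e j van z Zz => [|e IH] j van z Zz; first by rewrite addr0 scale1r.
rewrite exprSr -scalerA => h.
have Bz : cobnd K L (j + 1) ('X_l *: z).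
  apply: IH.
  - by move=> j' hj; apply: van; apply: le_trans hj; rewrite lerDl.
  - case: Zz => Kz Lz; split; [|rewrite cech_diffZ]; exact: cech_piece_X.
  - by rewrite -addrA -intS.
have [b Zb cb] := conn_total Zz Bz; apply: conn_cobnd cb _ => //.
exact: (dimle0P (van j (lexx j))).
Qed.

End Injective.
End Multiplication.

(** When all variables kill K/L, its proper localizations vanish and the
    complex reduces to K/L itself. *)
Lemma coh_torsion K L j n : gsub K -> gsub L ->
  (forall l i m, K i m -> L (i + 1) ('X_l *: m)) -> dimle (K j) (L j) n ->
  coh_dimle K L j n.
Proof.
move=> hK hL tors dn.
pose base (m : M) : cech M :=
  fam 0 (fun S : {set 'I_d} => if S == finset.set0 then m else 0).
have baseL (c : k) (m m' : M) : base (c%:MP *: m + m') = c%:MP *: base m + base m'.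
  rewrite /base fam_linear; congr fam; apply: functional_extensionality_dep => S.
  by case: ifP => // _; rewrite scaler0 addr0.
have base_piece (P : int -> set M) (m : M) : gsub P -> P j m -> cech_piece P j (base m).
  move=> hP Pm; apply: fam_piece => S; rewrite mul0n addr0.
  by case: ifP => // _; apply: ksub0; exact: gsub_ksub.
have base0 : base 0 = 0.
  by apply: functional_extensionality_dep => S;
    rewrite /base /fam; case: ifP => _; rewrite frac0.
pose rho z (m : M) := K j m /\ cech_piece L j (z - base m).
have cL := cech_piece_ksub j hL.
apply: (dimle_rel0 (rho := rho) (cocyc_ksub j hK hL) (cobnd_ksub j hK hL)
  (gsub_ksub j hK) (gsub_ksub j hL) _ _ _ _ dn).
- by split; [apply: ksub0; exact: gsub_ksub|rewrite base0 subr0; exact: ksub0].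
- move=> c u v m m' [Km Lu] [Km' Lv]; split.
    by case: (gsub_ksub j hK) => _; apply.
  by rewrite baseL opprD addrACA -scalerBr; case: cL => _; apply.
- move=> z [/(cech_pieceP hK)[a /(_ _ (leqnn _))[m -> hm]] _].
  have h0 : K j (m finset.set0) by have := hm finset.set0; rewrite cards0 muln0 addr0.
  exists (m finset.set0) => //; split=> //.
  have -> : base (m finset.set0) = fam a (fun S : {set 'I_d} => if S == finset.set0 then m S else 0).
    rewrite /base -(fam_expand 0 a) add0n; congr fam; apply: functional_extensionality_dep => S.
    by case: ifP => [/eqP ->|_]; rewrite ?scaler0 // /varprod big_set0 expr1n scale1r.
  rewrite -scaleN1r fam_scale fam_add -(fam_expand a 1); apply: fam_piece => S.
  rewrite expr1 scaleN1r; case: ifP => [_|/negbT /set0Pn[l lS]].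
    by rewrite subrr scaler0; apply: ksub0; exact: gsub_ksub.
  rewrite subr0 (varprodD1 k lS) -scalerA.
  have -> : j + ((a + 1) * #|S|)%N%:Z = j + (a * #|S|)%N%:Z + #|S :\ l|%:Z + 1.
    by rewrite (cardsD1 l S) lS; lia.
  by apply: tors; apply: gsub_varprod.
- move=> z m _ Lm [_ Lz]; apply: cobnd_sub => //.
  by rewrite -(subrK (base m) z); apply: (ksubD cL) => //; exact: base_piece.
Qed.

End RelativeCohomology.

(** * Noetherian induction *)

Section Dickson.

(** Move repeatedly to the position of the minimum of the remaining values. *)
Lemma monotone_subsequence (f : nat -> nat) :
  exists2 phi : nat -> nat, {homo phi : i j / (i < j)%N}
    & {homo f \o phi : i j / (i <= j)%N}.
Proof.
have min n : exists m, (n <= m)%N /\ forall i, (n <= i)%N -> (f m <= f i)%N.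
  have ex : exists v, `[< exists2 m, (n <= m)%N & f m = v >].
    by exists (f n); apply/asboolP; exists n.
  case: (ex_minnP ex) => v /asboolP[m nm <-] h; exists m; split=> // i ni.
  by apply: h; apply/asboolP; exists i.
have [mu hmu] := choice min.
pose phi := fix phi i := if i is i'.+1 then mu (phi i').+1 else mu 0%N.
exists phi; first by apply: (homo_ltn ltn_trans) => i; case: (hmu (phi i).+1).
apply: (homo_leq leqnn leq_trans) => i /=.
have [n [_ hn] ->] : exists2 n, (n <= mu n)%N /\ (forall i, (n <= i)%N -> (f (mu n) <= f i)%N)
    & phi i = mu n.
  by case: i => [|i]; [exists 0%N|exists (phi i).+1] => //; exact: hmu.
have [h _] := hmu (mu n).+1; apply: hn; apply: leq_trans (ltnW h).
by have [] := hmu n.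
Qed.

Lemma dickson N (s : nat -> 'X_{1..N}) :
  exists i j, (i < j)%N /\ (s i <= s j)%MM.
Proof.
have sub c : (c <= N)%N -> exists2 phi : nat -> nat, {homo phi : i j / (i < j)%N} &
    forall l : 'I_N, (l < c)%N -> {homo (fun i => s (phi i) l) : i j / (i <= j)%N}.
  elim: c => [|c IH] cN; first by exists id.
  have [phi hphi hs] := IH (ltnW cN).
  have [psi hpsi ht] := monotone_subsequence (fun i => s (phi i) (Ordinal cN)).
  exists (phi \o psi) => [i j ij|l]; first exact/hphi/hpsi.
  rewrite ltnS leq_eqVlt => /predU1P[lc|lc] i j ij; last first.
    by apply: hs => //; rewrite leq_eqVlt in ij; case/predU1P: ij => [-> //|/hpsi/ltnW].
  have -> : l = Ordinal cN by exact/val_inj.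
  exact: ht.
have [phi hphi hs] := sub N (leqnn N).
exists (phi 0%N), (phi 1%N); split; first exact: hphi.
by apply/mnm_lepP => l; apply: hs.
Qed.

End Dickson.

(** The ascending chain condition for the homogeneous ideals of a graded algebra
    generated by elements g_i. The algebra is not constructed: its graded pieces
    are spanned by monomials in the g_i inside R, where different pieces may
    overlap. The order on monomials in the g_i replaces a presentation. *)
Section NoetherianInduction.
Local Open Scope classical_set_scope.
Local Open Scope ring_scope.
Variables (k : fieldType) (d : nat).
Local Notation R := {mpoly k[d]}.
Variables (N : nat) (g : 'I_N -> R).
Local Notation phi := (mmap1 g).

Inductive mspan (D : 'X_{1..N} -> Prop) : R -> Prop :=
| mspan0 : mspan D 0
| mspanS c m v : D m -> mspan D v -> mspan D (c%:MP * phi m + v).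

Lemma mspan_phi (D : 'X_{1..N} -> Prop) m : D m -> mspan D (phi m).
Proof.
move=> Dm; have := mspanS 1 Dm (mspan0 D).
by rewrite addr0 mpolyC1 mul1r.
Qed.

Lemma phiD m m' : phi (m + m')%MM = phi m * phi m'.
Proof. by apply: commr_mmap1_M => i x; apply: mulrC. Qed.

Lemma mspanD D u v : mspan D u -> mspan D v -> mspan D (u + v).
Proof.
move=> hu hv; elim: hu => [|c m w Dm _ IH]; first by rewrite add0r.
by rewrite -addrA; apply: mspanS.
Qed.

Lemma mspanZ D (c : k) u : mspan D u -> mspan D (c%:MP * u).
Proof.
elim=> [|e m v Dm _ IH]; first by rewrite mulr0; exact: mspan0.
by rewrite mulrDr mulrA -mpolyCM; apply: mspanS.
Qed.

Lemma mspan_sub (D D' : 'X_{1..N} -> Prop) u : (forall m, D m -> D' m) ->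
  mspan D u -> mspan D' u.
Proof. by move=> DD; elim=> [|c m v /DD ? _]; [exact: mspan0|exact: mspanS]. Qed.

Lemma mspan_mul (D D' : 'X_{1..N} -> Prop) m u :
  (forall m', D m' -> D' (m + m')%MM) -> mspan D u -> mspan D' (phi m * u).
Proof.
move=> DD; elim=> [|c m' v Dm' _ IH]; first by rewrite mulr0; exact: mspan0.
by rewrite mulrDr mulrCA -phiD; apply: mspanS => //; apply: DD.
Qed.

Lemma mspan_lead D u : mspan D u -> u = 0 \/
  exists m (c : k), D m /\
    mspan (fun m' => D m' /\ (m' < m)%O) (u - c%:MP * phi m).
Proof.
elim=> [|c m v Dm _ [->|[m' [c' [Dm' hv]]]]]; first by left.
  by right; exists m, c; split=> //; rewrite addr0 subrr; exact: mspan0.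
right; case: (ltgtP m m') => [mm'|mm'|mm'].
- exists m', c'; split=> //; rewrite -addrA; apply: mspanS => //.
- exists m, c; split=> //; rewrite addrAC subrr add0r.
  rewrite -(subrK (c'%:MP * phi m') v); apply: mspanD.
    by apply: mspan_sub hv => n [Dn nm']; split=> //; apply: lt_trans mm'.
  by rewrite -[X in mspan _ X]addr0; apply: mspanS => //; exact: mspan0.
- exists m', (c + c'); split=> //; subst m'.
  by rewrite mpolyCD mulrDl opprD addrACA subrr add0r.
Qed.

Variables (G : Type) (deg : 'X_{1..N} -> G) (sh : 'X_{1..N} -> G -> G).
Hypothesis degD : forall m m', deg (m + m')%MM = sh m (deg m').

Definition gr_closed (L : G -> set R^o) : Prop :=
  [/\ forall c, ksub (L c),
      forall c v, L c v -> mspan (fun m => deg m = c) v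
    & forall m c v, L c v -> L (sh m c) (phi m * v)].

(** The monomials in the g_i that are initial for some element of L; as the g_i
    may satisfy relations, an element can have several expressions. *)
Definition initial (L : G -> set R^o) m : Prop :=
  exists2 v, L (deg m) v
    & mspan (fun m' => deg m' = deg m /\ (m' < m)%O) (v - phi m).

Lemma initial_up L m m' : gr_closed L -> (m <= m')%MM -> initial L m -> initial L m'.
Proof.
move=> [_ _ hL] /submK <- [v Lv hv]; exists (phi (m' - m)%MM * v).
  by rewrite degD; apply: hL.
rewrite phiD -mulrBr; apply: mspan_mul hv => n [dn nm].
by rewrite !degD dn ltmc_add2r.
Qed.

(** Division with remainder: subtracting multiples of elements of L lowers the
    leading monomial of an element of L' until it vanishes. *)
Lemma initial_inj (L L' : G -> set R^o) : gr_closed L -> gr_closed L' ->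
  (forall c v, L c v -> L' c v) -> (forall m, initial L' m -> initial L m) ->
  forall c v, L' c v -> L c v.
Proof.
move=> [kL _ _] [kL' sL' _] LL' UU c v L'v; have := sL' _ _ L'v.
suff main m : forall v (a : k), L' c v -> deg m = c ->
    mspan (fun m' => deg m' = c /\ (m' < m)%O) (v - a%:MP * phi m) -> L c v.
  move=> /mspan_lead[->|[m [a [dm hv]]]]; first exact: (ksub0 (kL c)).
  exact: main hv.
move: m {v L'v}; apply: (ltmwf (n := N)) => m IH v a L'v dm hv.
have low w : L' c w -> mspan (fun m' => deg m' = c /\ (m' < m)%O) w -> L c w.
  move=> L'w /mspan_lead[->|[m' [b [[dm' mm'] hw]]]]; first exact: (ksub0 (kL c)).
  apply: (IH m' mm' w b L'w dm'); apply: mspan_sub hw => n [[dn _] nm'].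
  by [].
have [a0|a0] := eqVneq a 0; first by apply: low => //; move: hv; rewrite a0 mpolyC0 mul0r subr0.
have [|w Lw hw] := UU m.
  exists ((a^-1)%:MP *: v); first by rewrite dm; exact: (ksubZ a^-1 (kL' c)).
  have := mspanZ a^-1 hv; rewrite mulrBr mulrA -mpolyCM mulVf // mul1r dm.
  by [].
rewrite dm in Lw hw.
have L'w := LL' _ _ Lw.
have : L c (v - a%:MP *: w).
  apply: low; first exact: (ksubB (kL' c) L'v (ksubZ a (kL' c) L'w)).
  have := mspanD hv (mspanZ (- a) hw).
  rewrite mpolyCN mulNr mulrBr opprB addrA subrK.
  by [].
by move=> h; have := ksubD (kL c) h (ksubZ a (kL c) Lw); rewrite subrK.
Qed.

(** An infinite strictly ascending chain would yield a sequence of initial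
    monomials none of which divides a later one. *)
Lemma noetherian_induction (P : (G -> set R^o) -> Prop) :
  (forall L, gr_closed L ->
    (forall L', gr_closed L' -> (forall c v, L c v -> L' c v) ->
       (exists c v, L' c v /\ ~ L c v) -> P L') -> P L) ->
  forall L, gr_closed L -> P L.
Proof.
move=> step L0 hL0; apply: contrapT => nP0.
pose bad := {L : G -> set R^o | gr_closed L /\ ~ P L}.
have next (X : bad) : exists Y : bad,
    (forall c v, sval X c v -> sval Y c v) /\
    exists m, initial (sval Y) m /\ ~ initial (sval X) m.
  case: X => L [hL nP] /=; apply: contrapT => no; apply: nP.
  apply: step => // L' hL' LL' [c [v [L'v nLv]]]; apply: contrapT => nP'.
  apply: no; exists (exist _ L' (conj hL' nP')); split=> //=.
  apply: contrapT => no; apply: nLv; apply: initial_inj L'v => // m U'm.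
  by apply: contrapT => nU; apply: no; exists m.
have [nx hnx] := choice next.
pose X i := iter i nx (exist _ L0 (conj hL0 nP0) : bad).
have mono i j : (i <= j)%N -> forall c v, sval (X i) c v -> sval (X j) c v.
  move=> /subnK <-; elim: (j - i)%N => [//|n IH] c v /IH h.
  by rewrite addSn; case: (hnx (X (n + i)%N)) => + _; apply.
have [s hs] := choice (fun i => proj2 (hnx (X i))).
have [i [j [ij le_s]]] := dickson s.
have [Us _] := hs i; have [_ nUs] := hs j.
have [hXj _] := proj2_sig (X j); have [hXi _] := proj2_sig (nx (X i)).
apply: nUs; apply: (initial_up hXj le_s).
by case: Us => v Xv hv; exists v => //; apply: (mono i.+1 j ij).
Qed.

End NoetherianInduction.

(** * Homogeneous ideals of the polynomial ring *)

Section HomogeneousPieces.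
Local Open Scope classical_set_scope.
Local Open Scope ring_scope.
Variables (k : fieldType) (d : nat).
Local Notation R := {mpoly k[d]}.
Local Notation piece := (@mpoly_piece k d).
Local Notation proj := (pihomog mdeg).

Lemma piece_dhomog n p : piece n%:Z p <-> p \is n.-homog for mdeg.
Proof.
split=> [h|/dhomogP h m /h ->//]; apply/dhomogP => m /h [].
by [].
Qed.

Lemma piece_neg (j : int) p : piece j p -> j < 0 -> p = 0.
Proof.
move=> h j0; apply/mpolyP => m; rewrite mcoeff0; apply/memN_msupp_eq0.
by apply/negP => /h E; move: j0; rewrite -E ltNge lez_nat.
Qed.

Lemma piece_ksub j : ksub (piece j : set R^o).
Proof.
split=> [m|c u v hu hv m]; first by rewrite msupp0.
move=> /msuppD_le; rewrite mem_cat => /orP[|/hv //].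
have -> : c%:MP *: (u : R^o) = c *: (u : R) by rewrite -mul_mpolyC.
by move=> /msuppZ_le /hu.
Qed.

Lemma pieceM i j (u v : R) : piece i u -> piece j v -> piece (i + j) (u * v).
Proof.
move=> hu hv m /msuppM_le /allpairsP[[m1 m2] /= [/hu <- /hv <- ->]].
by rewrite mdegD.
Qed.

Lemma piece1 : piece 0 1.
Proof. by move=> m; rewrite msupp1 inE => /eqP ->; rewrite mdeg0. Qed.

Lemma pieceX l : piece 1 'X_l.
Proof. by move=> m; rewrite msuppX inE => /eqP ->; rewrite mdeg1. Qed.

Lemma piece_proj n (p : R) : piece n%:Z (proj n p).
Proof. by apply/piece_dhomog; exact: pihomogP. Qed.

Lemma proj_piece n p : piece n%:Z p -> proj n p = p.
Proof. by move=> /piece_dhomog /pihomog_dE. Qed.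

Lemma proj_piece_ne n i (p : R) : piece i%:Z p -> i != n -> proj n p = 0.
Proof. by move=> /piece_dhomog h /pihomog_ne0; apply. Qed.

Lemma proj_linear n (c : k) (p q : R) : proj n (c%:MP * p + q) = c%:MP * proj n p + proj n q.
Proof. by rewrite !mul_mpolyC linearP. Qed.

Lemma proj_sum (p : R) : exists D : nat, p = \sum_(n < D) proj n p.
Proof. by eexists; apply: pihomog_partitionE; apply: leqnn. Qed.

Lemma piece_int_nat (j : int) (p : R) : piece j p -> p != 0 -> exists n : nat, j = n%:Z.
Proof.
case: j => n; first by exists n.
by move=> h; rewrite (piece_neg h) // eqxx.
Qed.

End HomogeneousPieces.

Section FiniteGeneration.
Local Open Scope classical_set_scope.
Local Open Scope ring_scope.
Variables (k : fieldType) (d : nat).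
Local Notation R := {mpoly k[d]}.
Local Notation piece := (@mpoly_piece k d).
Variable (I : submodClosed R^o).

Definition generated (s : seq (R * nat)) (v : R) : Prop :=
  exists q : nat -> R, v = \sum_(t < size s) q t * (nth (0, 0%N) s t).1.

Lemma generated_submod s (a u v : R) : generated s u -> generated s v ->
  generated s (a * u + v).
Proof.
move=> [q ->] [q' ->]; exists (fun t => a * q t + q' t).
rewrite mulr_sumr -big_split; apply: eq_bigr => t _ /=.
by rewrite mulrDl mulrA.
Qed.

Lemma generated0 s : generated s 0.
Proof. by exists (fun=> 0); rewrite big1 // => t _; rewrite mul0r. Qed.

Lemma generated_cons x s v : generated s v -> generated (x :: s) v.
Proof.
move=> [q ->]; exists (fun t => if t is t'.+1 then q t' else 0).
by rewrite /= big_ord_recl /= mul0r add0r.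
Qed.

Lemma generated_head x s : generated (x :: s) x.1.
Proof.
exists (fun t => if t is 0 then 1 else 0).
rewrite /= big_ord_recl /= mul1r big1 ?addr0 // => t _.
by rewrite mul0r.
Qed.

Lemma mspan_piece j (v : R) : piece j v ->
  mspan (fun l : 'I_d => 'X_l) (fun m => (mdeg m)%:Z = j) v.
Proof.
move=> h; rewrite [v]mpolyE big_seq.
elim/big_ind: _ => [|u w hu hw|m mv]; first exact: mspan0.
  exact: mspanD.
rewrite -mul_mpolyC mpolyXE_id; apply: mspanZ.
by apply: (@mspan_phi _ _ _ (fun l : 'I_d => 'X_l)); exact: h.
Qed.

(** Noetherian induction on the ideals generated by finitely many homogeneous
    elements of I. *)
Lemma homogeneous_fin_gen : homogeneous_ideal I ->
  exists s : seq (R * nat),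
    (forall x, x \in s -> (x.1 : R^o) \in I /\ piece x.2%:Z x.1) /\
    forall p : R, (p : R^o) \in I -> generated s p.
Proof.
move=> homI.
pose fg (L : int -> set R^o) := forall s : seq (R * nat),
  (forall x, x \in s -> (x.1 : R^o) \in I /\ piece x.2%:Z x.1) ->
  (forall j v, L j v <-> piece j v /\ generated s v) ->
  exists s : seq (R * nat),
    (forall x, x \in s -> (x.1 : R^o) \in I /\ piece x.2%:Z x.1) /\
    forall p : R, (p : R^o) \in I -> generated s p.
have closed s L : (forall j v, L j v <-> piece j v /\ generated s v) ->
    gr_closed (fun l : 'I_d => 'X_l : R) (fun m => (mdeg m)%:Z)
      (fun m j => (mdeg m)%:Z + j) L.
  move=> hL; split=> [j|j v|m j v].
  - split; first by apply/hL; split; [exact: (ksub0 (@piece_ksub k d j))|exact: generated0].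
    move=> c u v /hL[pu gu] /hL[pv gv]; apply/hL; split; last exact: generated_submod.
    by case: (@piece_ksub k d j) => _; apply.
  - by move=> /hL[/mspan_piece].
  - move=> /hL[pv gv]; apply/hL; split.
      apply: pieceM => // m'; rewrite /mmap1 -mpolyXE_id msuppX inE.
      by move=> /eqP ->.
    by rewrite -[_ * v]addr0; apply: generated_submod => //; exact: generated0.
suff main L : gr_closed (fun l : 'I_d => 'X_l : R) (fun m => (mdeg m)%:Z)
      (fun m j => (mdeg m)%:Z + j) L -> fg L.
  apply: (main (fun j => [set v | piece j v /\ generated [::] v]) _ [::]) => //.
  exact: (closed [::]).
apply: noetherian_induction => [m m'|{}L hL IH s hs hLs]; first by rewrite mdegD.
have [[n [p [Ip hp ngp]]]|no] := pselect (exists (n : nat) (p : R),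
    [/\ (p : R^o) \in I, piece n%:Z p & ~ generated s p]); last first.
  exists s; split=> // p Ip; have [D ->] := proj_sum p.
  elim/big_ind: _ => [|u v gu gv|n _]; first exact: generated0.
    by rewrite -[u]mul1r; apply: generated_submod.
  apply: contrapT => ng; apply: no; exists n, (pihomog mdeg n p); split=> //.
    exact: homI.
  exact: piece_proj.
have hL' := closed ((p, n) :: s) (fun j => [set v | piece j v /\ generated ((p, n) :: s) v]).
apply: (IH (fun j => [set v | piece j v /\ generated ((p, n) :: s) v])
  _ _ _ ((p, n) :: s)) => //.
- exact: hL'.
- by move=> j v /hLs[pv gv]; split=> //; apply: generated_cons.
- exists n%:Z, p; split; first by split=> //; exact: (generated_head (p, n)).
  by move=> /hLs[].
- by move=> x; rewrite inE => /predU1P[->|/hs].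
Qed.

End FiniteGeneration.

(** * The Rees algebra *)

Section IdealPowers.
Local Open Scope ring_scope.
Variables (R : comNzRingType) (I : {pred R^o}).

Lemma ideal_power0 (u : R) : (u : R^o) \in ideal_power I 0.
Proof.
apply/asboolP; exists [:: (u, [tuple] : 0.-tuple R)].
  by move=> t; rewrite inE => /eqP -> y; rewrite in_nil.
by rewrite big_seq1 big_nil mulr1.
Qed.

Lemma ideal_power1 (u : R) : (u : R^o) \in I -> (u : R^o) \in ideal_power I 1.
Proof.
move=> Iu; apply/asboolP; exists [:: (1, [tuple u])].
  by move=> t; rewrite inE => /eqP -> y; rewrite inE => /eqP ->.
by rewrite big_seq1 big_seq1 mul1r.
Qed.

Lemma ideal_powerM n m (u v : R) : (u : R^o) \in ideal_power I n ->
  (v : R^o) \in ideal_power I m -> (u * v : R^o) \in ideal_power I (n + m).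
Proof.
move=> /asboolP[s hs ->] /asboolP[t ht ->]; apply/asboolP.
exists [seq (a.1 * b.1, cat_tuple a.2 b.2) | a <- s, b <- t].
  move=> _ /allpairsP[[a b] /= [/hs ha /ht hb ->]] y /=.
  by rewrite mem_cat => /orP[/ha|/hb].
rewrite big_allpairs_dep mulr_suml; apply: eq_bigr => a _.
rewrite mulr_sumr; apply: eq_bigr => b _ /=.
by rewrite big_cat /= mulrACA.
Qed.

Lemma ideal_power_decr n (u : R) : (u : R^o) \in ideal_power I n.+1 ->
  (u : R^o) \in ideal_power I n.
Proof.
move=> /asboolP[s hs ->]; apply/asboolP.
exists [seq (t.1 * thead t.2, behead_tuple t.2) | t <- s].
  by move=> _ /mapP[t /hs ht ->] y /= /mem_behead /ht.
rewrite big_map; apply: eq_bigr => t _ /=.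
by rewrite {1}(tuple_eta t.2) big_cons mulrA.
Qed.

End IdealPowers.

(** The Rees algebra of I is handled through its bigraded pieces, which are
    subspaces of R, and a bihomogeneous ideal of it through its own pieces. *)
Section Rees.
Local Open Scope classical_set_scope.
Local Open Scope ring_scope.
Variables (k : fieldType) (d : nat).
Local Notation R := {mpoly k[d]}.
Local Notation piece := (@mpoly_piece k d).
Variable (I : submodClosed R^o).
Hypothesis homI : homogeneous_ideal I.

Definition rees (n : nat) (j : int) : set R^o :=
  [set v | piece j v /\ v \in ideal_power I n].

Record rees_ideal (L : nat -> int -> set R^o) : Prop := ReesIdeal {
  rees_ideal_gsub : forall n, gsub (L n);
  rees_ideal_sub : forall n j v, L n j v -> rees n j v;
  rees_ideal_mul : forall n m i j u v, rees n i u -> L m j v ->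
    L (n + m)%N (i + j) (u * v : R) }.

Lemma rees_gsub n : gsub (rees n).
Proof.
split=> [j|j l m [pm Im]]; last first.
  split; first by rewrite addrC; apply: pieceM => //; exact: pieceX.
  exact: (@rpredZ _ _ (ideal_power I n)).
split; first by split; [exact: (ksub0 (@piece_ksub k d j))|exact: (@rpred0 _ (ideal_power I n))].
move=> c u v [pu Iu] [pv Iv]; split.
  by case: (@piece_ksub k d j) => _; apply.
by apply: (@rpredD _ (ideal_power I n)) => //; exact: (@rpredZ _ _ (ideal_power I n)).
Qed.

Lemma reesM n m i j u v : rees n i u -> rees m j v -> rees (n + m) (i + j) (u * v : R).
Proof.
by move=> [pu Iu] [pv Iv]; split; [exact: pieceM|exact: ideal_powerM].
Qed.

Lemma rees1 : rees 0 0 1.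
Proof. by split; [exact: piece1|exact: ideal_power0]. Qed.

Lemma reesX l : rees 0 1 'X_l.
Proof. by split; [exact: pieceX|exact: ideal_power0]. Qed.

Lemma rees_neg n j v : rees n j v -> j < 0 -> v = 0.
Proof. by case=> pv _; exact: piece_neg. Qed.

Definition wsum N (c : 'I_N -> nat) (m : 'X_{1..N}) : nat := (\sum_i c i * m i)%N.

Lemma wsumD N (c : 'I_N -> nat) m m' : wsum c (m + m')%MM = (wsum c m + wsum c m')%N.
Proof. by rewrite /wsum -big_split; apply: eq_bigr => i _; rewrite mnmDE mulnDr. Qed.

Lemma wsum0 N (c : 'I_N -> nat) : wsum c 0%MM = 0%N.
Proof. by rewrite /wsum big1 // => i _; rewrite mnm0E muln0. Qed.

Lemma wsumU N (c : 'I_N -> nat) i : wsum c U_(i)%MM = c i.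
Proof.
rewrite /wsum (bigD1 i) //= mnm1E eqxx muln1 big1 ?addn0 // => i' ne.
by rewrite mnm1E eq_sym (negbTE ne) muln0.
Qed.

Lemma rees_monomial N (g : 'I_N -> R) (e w : 'I_N -> nat) m :
  (forall i, rees (e i) (w i) (g i)) -> rees (wsum e m) (wsum w m) (mmap1 g m).
Proof.
move=> gP; rewrite /wsum /mmap1; elim/big_rec3: _ => [|i x y z _ h]; first exact: rees1.
rewrite PoszD; apply: reesM => //; elim: (m i) => [|n IH].
  by rewrite !muln0 expr0; exact: rees1.
by rewrite exprS !mulnS PoszD; apply: reesM.
Qed.

(** The Rees algebra is generated by the variables and by homogeneous
    generators of I; e i and w i are the bidegree of the generator g i. *)
Lemma rees_generators : exists N (g : 'I_N -> R) (e w : 'I_N -> nat),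
  [/\ forall i, rees (e i) (w i) (g i),
      forall i, e i = 0%N -> exists l, g i = 'X_l /\ w i = 1%N &
      forall n j v, rees n j v -> mspan g (fun m =>
        wsum e m = n /\ (wsum w m)%:Z = j) v].
Proof.
have [s [hs gen]] := homogeneous_fin_gen homI.
pose g (i : 'I_(d + size s)) : R :=
  match split i with inl l => 'X_l | inr t => (nth (0, 0%N) s t).1 end.
pose e (i : 'I_(d + size s)) := if split i is inr _ then 1%N else 0%N.
pose w (i : 'I_(d + size s)) :=
  match split i with inl _ => 1%N | inr t => (nth (0, 0%N) s t).2 end.
have gP i : rees (e i) (w i) (g i).
  rewrite /g /e /w; case: (split i) => [l|t]; first exact: reesX.
  have [It pt] := hs _ (mem_nth (0, 0%N) (ltn_ord t)).
  by split=> //; exact: ideal_power1.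
exists (d + size s)%N, g, e, w; split=> //.
  by move=> i; rewrite /g /e /w; case: (split i) => // l _; exists l.
have phiP m := rees_monomial m gP.
pose S n := mspan g (fun m => wsum e m = n).
have SM n m u v : S n u -> S m v -> S (n + m)%N (u * v).
  move=> hu hv; elim: hu => [|c m' u' hm' _ IH]; first by rewrite mul0r; exact: mspan0.
  rewrite mulrDl -mulrA; apply: mspanD IH; apply: mspanZ.
  by apply: mspan_mul hv => m'' <-; rewrite wsumD hm'.
have S1 : S 0%N 1 by rewrite -(mmap11 g); apply: mspan_phi; exact: wsum0.
have Sg i : S (e i) (g i) by rewrite -(mmap1U g); apply: mspan_phi; exact: wsumU.
have SX l : S 0%N 'X_l.
  by have := Sg (lshift (size s) l); rewrite /g /e (unsplitK (inl l)).
have S0 u : S 0%N u.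
  rewrite [u]mpolyE; elim/big_ind: _ => [|x y hx hy|m _]; first exact: mspan0.
    exact: mspanD.
  rewrite -mul_mpolyC; apply: mspanZ; rewrite mpolyXE_id.
  elim/big_ind: _ => [|x y hx hy|i _]; [exact: S1|exact: (SM 0%N 0%N)|].
  elim: (m i) => [|n IH]; first by rewrite expr0; exact: S1.
  by rewrite exprS; exact: (SM 0%N 0%N).
have SI u : (u : R^o) \in I -> S 1%N u.
  move=> /gen[q ->]; elim/big_ind: _ => [|x y hx hy|t _]; first exact: mspan0.
    exact: mspanD.
  apply: (SM 0%N 1%N) => //.
  by have := Sg (rshift d t); rewrite /g /e (unsplitK (inr t)).
have Sprod l : (forall y : R, y \in l -> (y : R^o) \in I) -> S (size l) (\prod_(y <- l) y).
  elim: l => [|y l IH] hl; first by rewrite big_nil.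
  rewrite big_cons; apply: (SM 1%N).
    by apply: SI; apply: hl; rewrite mem_head.
  by apply: IH => z zl; apply: hl; rewrite inE zl orbT.
have Spow n u : (u : R^o) \in ideal_power I n -> S n u.
  move=> /asboolP[t ht ->]; rewrite big_seq.
  elim/big_ind: _ => [|x y hx hy|a at_]; first exact: mspan0.
    exact: mspanD.
  apply: (SM 0%N n) => //; have := Sprod a.2 (ht a at_).
  by rewrite size_tuple.
move=> n j v [pv /Spow Sv].
have [->|v0] := eqVneq v 0; first exact: mspan0.
have [i ij] := piece_int_nat pv v0; subst j.
rewrite -(proj_piece pv); elim: Sv => [|c m u dm _ IH].
  by rewrite pihomog0; exact: mspan0.
rewrite proj_linear; have [pm _] := phiP m.
have [wi|wi] := eqVneq (wsum w m) i; last first.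
  by rewrite (proj_piece_ne pm wi) mulr0 add0r.
rewrite -wi in IH *; rewrite (proj_piece pm).
by apply: mspanS.
Qed.

Lemma rees_induction (P : (nat -> int -> set R^o) -> Prop) :
  (forall L, rees_ideal L ->
    (forall L', rees_ideal L' -> (forall n j v, L n j v -> L' n j v) ->
       (exists n j v, L' n j v /\ ~ L n j v) -> P L') -> P L) ->
  forall L, rees_ideal L -> P L.
Proof.
have [N [g [e [w [gP _ gS]]]]] := rees_generators.
pose bideg m := (wsum e m, (wsum w m)%:Z).
pose sh m (c : nat * int) := ((wsum e m + c.1)%N, (wsum w m)%:Z + c.2).
pose unc (L : nat -> int -> set R^o) (c : nat * int) := L c.1 c.2.
move=> step L0 hL0.
pose Q (X : nat * int -> set R^o) :=
  rees_ideal (fun n j => X (n, j)) -> P (fun n j => X (n, j)).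
have closed L : rees_ideal L -> gr_closed g bideg sh (unc L).
  case=> gL sL mL; split=> [[n j]|[n j] v|m [n j] v]; first exact: gsub_ksub.
    move=> /sL /gS; apply: mspan_sub => m [h1 h2].
    by rewrite /bideg h1 h2.
  by apply: mL; exact: rees_monomial.
suff : Q (unc L0) by apply.
have bidegD m m' : bideg (m + m')%MM = sh m (bideg m').
  by rewrite /bideg /sh /= -PoszD !wsumD.
apply: (noetherian_induction bidegD _ (closed _ hL0)) => X hX IH hL.
apply: step => // L' hL' LL' [n [j [v [L'v nLv]]]].
have := IH (unc L') (closed _ hL'); apply=> //.
  by case=> n' j' v' /LL'.
by exists (n, j), v.
Qed.

(** Generators of I^n have degree at most C n, where C bounds the degrees of the
    generators of I. *)
Lemma rees_top_degree : exists C, forall n j v, (C * n)%N%:Z < j ->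
  rees n j v -> exists2 u : 'I_d -> R, forall l, rees n (j - 1) (u l)
    & v = \sum_l 'X_l * u l.
Proof.
have [N [g [e [w [gP g0 gS]]]]] := rees_generators.
exists (\max_i w i)%N => n j v hj /gS.
elim=> [|c m u [hn hw] _ [q hq ->]].
  exists (fun=> 0) => [l|]; first exact: (ksub0 (gsub_ksub _ (rees_gsub n))).
  by rewrite big1 // => l _; rewrite mulr0.
have [i [ei mi]] : exists i, e i = 0%N /\ m i != 0%N.
  apply: contrapT => no; move: hj; rewrite -hw -hn ltz_nat ltnNge /wsum big_distrr /=.
  rewrite leq_sum // => i _; have [mi|mi] := eqVneq (m i) 0%N; first by rewrite mi muln0.
  have ei : (0 < e i)%N by rewrite lt0n; apply/eqP => ei; apply: no; exists i.
  apply: leq_trans (leq_mul (leq_bigmax i) (leqnn (m i))) _.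
  by rewrite mulnA leq_mul2r leq_pmulr // orbT.
have [l0 [gi wi]] := g0 i ei.
have mE : m = (m - U_(i) + U_(i))%MM.
  rewrite submK //; apply/mnm_lepP => i'; rewrite mnm1E.
  by case: eqP => [<-|//]; rewrite lt0n.
have := rees_monomial (m - U_(i))%MM gP.
have -> : wsum e (m - U_(i))%MM = n by rewrite -hn [in RHS]mE wsumD wsumU ei addn0.
have -> : (wsum w (m - U_(i))%MM)%:Z = j - 1.
  by rewrite -hw [in RHS]mE wsumD wsumU wi PoszD addrK.
set y := mmap1 g _ => hy.
exists (fun l => q l + if l == l0 then c%:MP * y else 0) => [l|].
  have hK := gsub_ksub (j - 1) (rees_gsub n).
  apply: (ksubD hK) => //; case: ifP => _; last exact: (ksub0 hK).
  exact: (ksubZ c hK).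
under [RHS]eq_bigr => l _ do rewrite mulrDr.
rewrite big_split [RHS]addrC /=; congr (_ + _).
rewrite (bigD1 l0) //= eqxx big1 => [|l /negbTE ->]; last by rewrite mulr0.
by rewrite addr0 [in LHS]mE phiD mmap1U gi -/y; ring.
Qed.

End Rees.

(** * Growth of cohomology over the Rees algebra *)

Section SumBounds.
Local Open Scope nat_scope.

Lemma sum_widen (F : nat -> nat) N M : N <= M -> \sum_(t < N) F t <= \sum_(t < M) F t.
Proof.
by move=> /subnKC <-; rewrite big_split_ord /= leq_addr.
Qed.

Lemma sum_shift (F : nat -> nat) b N : \sum_(t < N) F (b + t) <= \sum_(t < b + N) F t.
Proof. by rewrite [X in _ <= X]big_split_ord /= leq_addl. Qed.

Lemma sum_truncate (F : nat -> nat) N M : (forall t, M <= t -> F t = 0) ->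
  \sum_(t < N) F t <= \sum_(t < M) F t.
Proof.
move=> F0; have [NM|/ltnW/subnKC <-] := leqP N M; first exact: sum_widen.
by rewrite big_split_ord /= [X in _ + X]big1 ?addn0 // => t _; rewrite F0 // leq_addr.
Qed.

Lemma sum_nonneg (f : int -> nat) a N : (forall j, (j < 0)%R -> f j = 0) ->
  \sum_(t < N) f (t%:Z - a%:Z)%R <= \sum_(t < N) f t%:Z.
Proof.
move=> f0; apply: leq_trans (@sum_widen (fun t => f (t%:Z - a%:Z)%R) N (a + N) (leq_addl _ _)) _.
rewrite big_split_ord /= big1 ?add0n => [|t _]; last first.
  by apply: f0; rewrite subr_lt0 ltz_nat.
by apply: leq_sum => t _; rewrite PoszD addrAC subrr add0r.
Qed.

Lemma leq_exp2r_weak m n e : m <= n -> m ^ e <= n ^ e.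
Proof. by move=> mn; case: e => // e; rewrite leq_exp2r. Qed.

End SumBounds.

Section CohomologyGrowth.
Local Open Scope classical_set_scope.
Local Open Scope ring_scope.
Variables (k : fieldType) (d : nat).
Local Notation R := {mpoly k[d]}.
Variable (I : submodClosed R^o).
Hypothesis homI : homogeneous_ideal I.
Local Notation rees := (rees I).
Local Notation rees_ideal := (rees_ideal I).
Implicit Types (L : nat -> int -> set R^o).

Lemma mspan_dimle N (g : 'I_N -> R) (D : 'X_{1..N} -> Prop) (s : seq 'X_{1..N}) :
  (forall m, D m -> m \in s) -> dimle (mspan g D : set R^o) [set 0] (size s).
Proof.
move=> Ds; exists (fun t => mmap1 g (nth 0%MM s t)) => z.
suff h : mspan g D z -> exists c : nat -> k,
    z = \sum_(t < size s) (c t)%:MP * mmap1 g (nth 0%MM s t).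
  by move=> /h[c ->]; exists c; rewrite /= subrr.
elim=> [|c m v /Ds ms _ [a ->]].
  by exists (fun=> 0); rewrite big1 // => t _; rewrite mpolyC0 mul0r.
exists (fun t => (if t == index m s then c else 0) + a t).
under [RHS]eq_bigr => t _ do rewrite mpolyCD mulrDl.
rewrite big_split /=; congr (_ + _).
rewrite (bigD1 (Ordinal (eq_ind_r is_true ms (index_mem m s)))) //= eqxx nth_index //.
rewrite big1 ?addr0 // => t; rewrite -val_eqE /= => /negbTE ->.
by rewrite mpolyC0 mul0r.
Qed.

(** The common bound s on exponents lets all degrees j <= s be counted inside one
    finite type. *)
Definition monomials (s j : nat) : pred {ffun 'I_d -> 'I_s.+1} :=
  [pred f : {ffun 'I_d -> 'I_s.+1} | (\sum_i f i)%N == j].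
Arguments monomials : clear implicits.

Lemma sum_card_monomials s : (\sum_(j < s.+1) #|monomials s j| <= s.+1 ^ d)%N.
Proof.
have -> : (s.+1 ^ d = #|{: {ffun 'I_d -> 'I_s.+1}}|)%N by rewrite card_ffun !card_ord.
rewrite -[X in (_ <= X)%N]sum1_card.
rewrite (eq_bigr (fun j : 'I_s.+1 => \sum_(f in monomials s j) 1)%N); last first.
  by move=> j _; rewrite sum1_card.
rewrite (exchange_big_dep predT) //=; apply: leq_sum => f _.
rewrite sum1_card; apply/card_le1_eqP => x y hx hy; apply/val_inj => /=.
have /eqP <- : (\sum_i f i)%N == x := hx.
by have /eqP <- : (\sum_i f i)%N == y := hy.
Qed.

Lemma piece_dimle s j : (j <= s)%N ->
  dimle (mpoly_piece j%:Z : set R^o) [set 0] #|monomials s j|.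
Proof.
move=> js; pose mon (f : {ffun 'I_d -> 'I_s.+1}) := [multinom (f i : nat) | i < d].
have := @mspan_dimle d (fun l => 'X_l) (fun m => mdeg m = j)
  [seq mon f | f in monomials s j].
rewrite size_map -cardE => h; apply: dimle_sub (h _) => //.
  move=> z /mspan_piece; apply: mspan_sub => m [].
  by [].
move=> m mj; have mi i : (m i < s.+1)%N.
  rewrite ltnS; apply: leq_trans js; rewrite -mj mdegE (bigD1 i) //=.
  exact: leq_addr.
apply/fintype.imageP; exists [ffun i => Ordinal (mi i)].
  by rewrite inE -mj mdegE; apply/eqP; apply: eq_bigr => i _; rewrite ffunE.
by apply/mnmP => i; rewrite mnmE ffunE.
Qed.

Definition hilb L n (j : int) : nat := kdim (rees n j) (L n j).

Lemma hilbP L n (j : int) : rees_ideal L -> dimle (rees n j) (L n j) (hilb L n j).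
Proof.
move=> hL; have L0 := ksub0 (gsub_ksub j (rees_ideal_gsub hL n)).
have [s hs] : exists s, dimle (rees n j) (L n j) s; last exact: kdimP hs.
case: j L0 => j L0; last first.
  by exists 0%N; apply: dimle0 => z /rees_neg ->.
exists #|monomials j j|; apply: dimle_sub (piece_dimle (leqnn j)) => z.
  by case.
by move->.
Qed.

Lemma hilb_neg L n (j : int) : rees_ideal L -> j < 0 -> hilb L n j = 0%N.
Proof.
move=> hL j0; apply/eqP; rewrite -leqn0; apply: kdim_le; apply: dimle0 => z.
move=> /rees_neg ->//; exact: (ksub0 (gsub_ksub j (rees_ideal_gsub hL n))).
Qed.

(** The exponent e plays the role of the Krull dimension of rees / L. A cumulative
    Hilbert function makes its decrease along 'X_l elementary, without Hilbert
    polynomials. *)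
Definition growth L (D e : nat) : Prop := forall s,
  (\sum_(n < s.+1) \sum_(j < s.+1) hilb L n j%:Z <= D * s.+1 ^ e)%N.

(** The conclusion for rees / L: the cohomology of its n-th piece vanishes above a
    degree linear in n, and is bounded with the same exponent as the Hilbert
    function. Summing over m <= n keeps e = 0 meaningful and is what a filtration
    by the pieces needs; a is the negative range of internal degrees, on which
    the bound has to depend uniformly. *)
Definition tame L (e : nat) : Prop := exists C D (g : nat -> int -> nat),
  [/\ forall n j, coh_dimle (rees n) (L n) j (g n j),
      forall n j, (C * n.+1)%N%:Z < j -> g n j = 0%N &
      forall n a N, (\sum_(m < n.+1) \sum_(t < N) g m (t%:Z - a%:Z)%R
                     <= D * (n + a).+1 ^ e)%N].

(** Here cohomology is rees / L itself, and it lives in degrees at most C n since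
    rees n j is contained in L for larger j. *)
Lemma tame_torsion L e D : rees_ideal L -> (forall l, L 0%N 1 'X_l) ->
  growth L D e -> tame L e.
Proof.
move=> hL LX gr; have [C hC] := rees_top_degree homI.
have XL l n (i : int) m : rees n i m -> L n (i + 1) ('X_l * m : R).
  move=> Km; have := rees_ideal_mul hL Km (LX l).
  by rewrite addn0 mulrC.
have top n (j : int) : (C * n)%N%:Z < j -> hilb L n j = 0%N.
  move=> hj; apply/eqP; rewrite -leqn0; apply: kdim_le; apply: dimle0 => z.
  move=> /(hC n j _ hj)[u hu ->].
  apply: (ksub_sum _ (gsub_ksub j (rees_ideal_gsub hL n))) => l _.
  by have := XL l _ _ _ (hu l); rewrite subrK.
exists C, (D * C.+1 ^ e)%N, (hilb L); split.
- move=> n j; apply: coh_torsion; [exact: rees_gsub|exact: (rees_ideal_gsub hL)| |exact: hilbP].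
  by move=> l i m; exact: XL.
- move=> n j hj; apply: top; apply: le_lt_trans hj.
  by rewrite lez_nat leq_mul2l leqnSn orbT.
- move=> n a N; pose s := (C * n + n)%N.
  apply: (@leq_trans (\sum_(m < n.+1) \sum_(t < s.+1) hilb L m t%:Z)%N).
    apply: leq_sum => m _; apply: leq_trans (sum_nonneg _ _ _) _.
      by move=> j; exact: hilb_neg.
    apply: (@sum_truncate (fun t => hilb L m t%:Z)) => t st; apply: top.
    rewrite ltz_nat; apply: leq_ltn_trans st; rewrite /s.
    by apply: leq_trans (leq_addr _ _); rewrite leq_mul2l -ltnS ltn_ord orbT.
  apply: leq_trans (@sum_widen (fun m => \sum_(t < s.+1) hilb L m t%:Z)%N n.+1 s.+1 _) _.
    by rewrite ltnS leq_addl.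
  apply: leq_trans (gr s) _.
  rewrite -mulnA -expnMn leq_mul2l leq_exp2r_weak ?orbT //.
  by rewrite /s; nia.
Qed.

Section Step.
Variables (L : nat -> int -> set R^o) (l : 'I_d).
Hypothesis hL : rees_ideal L.
Let Lc n := colonX l (rees n) (L n).
Let La n := addX l (rees n) (L n).

Lemma rees_ideal_colonX : rees_ideal Lc.
Proof.
split=> [n|n j v [] //|n m i j u v Ku [Kv Lv]].
  by apply: colonX_gsub; [exact: rees_gsub|exact: (rees_ideal_gsub hL)].
split; first exact: reesM.
have := rees_ideal_mul hL Ku Lv; rewrite addrA.
have -> // : 'X_l *: (u * v : R^o) = (u * ('X_l *: (v : R^o)) : R) :> R.
by rewrite /GRing.scale /= mulrCA.
Qed.

Lemma rees_ideal_addX : rees_ideal La.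
Proof.
split=> [n|n j v|n m i j u v Ku [v1 [v2 [Lv1 Kv2 ->]]]].
- by apply: addX_gsub; [exact: rees_gsub|exact: (rees_ideal_gsub hL)].
- by apply: addX_sub; [exact: rees_gsub|exact: (rees_ideal_sub hL)].
- exists (u * v1 : R), (u * v2 : R); split; first exact: (rees_ideal_mul hL).
    by rewrite -addrA; exact: reesM.
  by rewrite /GRing.scale /= mulrDr mulrCA.
Qed.

Lemma addX_varX : La 0%N 1 'X_l.
Proof.
exists 0, 1; split; first exact: (ksub0 (gsub_ksub _ (rees_ideal_gsub hL 0))).
  by rewrite subrr; exact: rees1.
by rewrite add0r /GRing.scale /= mulr1.
Qed.

Lemma ideal_sub_addX n j v : L n j v -> La n j v.
Proof. by apply: sub_addX; exact: rees_gsub. Qed.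

Lemma hilb_colonX n j : (hilb Lc n j <= hilb L n (j + 1)%R)%N.
Proof.
apply: kdim_le; have hK := rees_gsub I n; have hLn := rees_ideal_gsub hL n.
apply: (dimle_rel0 (rho := fun m m' : R^o => m' = 'X_l *: m)
  (gsub_ksub j hK) (gsub_ksub j (rees_ideal_gsub rees_ideal_colonX n))
  (gsub_ksub (j + 1) hK) (gsub_ksub (j + 1) hLn) _ _ _ _ (hilbP n (j + 1) hL)).
- by rewrite scaler0.
- by move=> c a b a' b' -> ->; rewrite scalerDr scale_swap.
- by move=> z Kz; exists ('X_l *: z) => //; case: hK => _; apply.
- by move=> z w Kz Lw wE; split=> //; rewrite -wE.
Qed.

Lemma hilb_addX n j : (hilb La n j <= hilb L n j)%N.
Proof. by apply: kdim_le; apply: dimle_sub (hilbP n j hL) => // z; exact: ideal_sub_addX. Qed.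

(** The case where multiplication by 'X_l is not injective on rees / L: then
    both L : 'X_l and L + 'X_l are larger than L. *)
Lemma tame_colonX_addX e : tame Lc e -> tame La e -> tame L e.
Proof.
move=> [C1 [D1 [g1 [h1 v1 b1]]]] [C2 [D2 [g2 [h2 v2 b2]]]].
exists (C1 + C2 + 1)%N, (D2 + D1 * 2 ^ e)%N, (fun n j => (g2 n j + g1 n (j - 1)%R)%N).
split.
- move=> n j; apply: (coh_ext (K := La n)).
  + exact: (rees_ideal_gsub rees_ideal_addX).
  + exact: (rees_ideal_gsub hL).
  + exact: rees_gsub.
  + exact: ideal_sub_addX.
  + exact: (rees_ideal_sub rees_ideal_addX).
  + exact: h2.
  + by apply: coh_addX; [exact: rees_gsub|exact: (rees_ideal_gsub hL)|exact: h1].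
- by move=> n j hj; rewrite v1 ?v2 //; nia.
- move=> n a N; under eq_bigr => m _ do rewrite big_split /=.
  rewrite big_split mulnDl; apply: leq_add; first exact: b2.
  have -> : (\sum_(m < n.+1) \sum_(t < N) g1 m (t%:Z - a%:Z - 1)%R =
      \sum_(m < n.+1) \sum_(t < N) g1 m (t%:Z - a.+1%:Z)%R)%N.
    by apply: eq_bigr => m _; apply: eq_bigr => t _; congr g1; lia.
  apply: leq_trans (b1 n a.+1 N) _.
  rewrite -mulnA -expnMn leq_mul2l leq_exp2r_weak ?orbT //.
  by lia.
Qed.

Lemma growth_colonX D e : growth L D e -> growth Lc (D * 2 ^ e) e.
Proof.
move=> gr s; apply: (@leq_trans (\sum_(n < s.+2) \sum_(j < s.+2) hilb L n j%:Z)%N).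
  apply: leq_trans (@sum_widen (fun n => \sum_(j < s.+2) hilb L n j%:Z)%N s.+1 s.+2 _) => //.
  apply: leq_sum => n _.
  apply: leq_trans (@sum_shift (fun j => hilb L n j%:Z) 1 s.+1).
  by apply: leq_sum => j _; apply: leq_trans (hilb_colonX _ _) _; rewrite addrC.
apply: leq_trans (gr s.+1) _; rewrite -mulnA -expnMn leq_mul2l leq_exp2r_weak ?orbT //.
by lia.
Qed.

Lemma growth_addX D e : growth L D e -> growth La D e.
Proof.
move=> gr s; apply: leq_trans (gr s); apply: leq_sum => n _.
by apply: leq_sum => j _; exact: hilb_addX.
Qed.

Section Injective.
Hypothesis inj : forall n j m, rees n j m -> L n (j + 1) ('X_l *: m) -> L n j m.

Lemma hilb_step n (j : int) : (hilb La n (j + 1)%R + hilb L n j <= hilb L n (j + 1)%R)%N.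
Proof.
have hK := rees_gsub I n; have hLn := rees_ideal_gsub hL n.
have hLa := rees_ideal_gsub rees_ideal_addX n.
have := kdim_split (gsub_ksub (j + 1) hK) (gsub_ksub (j + 1) hLa)
  (gsub_ksub (j + 1) hLn) (@ideal_sub_addX n (j + 1))
  (rees_ideal_sub rees_ideal_addX (n := n) (j := j + 1)) (hilbP n (j + 1) hL).
apply: leq_trans; rewrite leq_add2l; apply: kdim_le.
have fin : dimle (La n (j + 1)) (L n (j + 1)) (kdim (La n (j + 1)) (L n (j + 1))).
  apply: kdimP; apply: dimle_sub (hilbP n (j + 1) hL) => // z.
  exact: (rees_ideal_sub rees_ideal_addX).
apply: (dimle_rel0 (rho := fun m m' : R^o => m' = 'X_l *: m)
  (gsub_ksub j hK) (gsub_ksub j hLn) (gsub_ksub (j + 1) hLa)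
  (gsub_ksub (j + 1) hLn) _ _ _ _ fin).
- by rewrite scaler0.
- by move=> c a b a' b' -> ->; rewrite scalerDr scale_swap.
- move=> z Kz; exists ('X_l *: z) => //; exists 0, z; rewrite addrK; split=> //.
    exact: (ksub0 (gsub_ksub _ hLn)).
  by rewrite add0r.
- by move=> z w Kz Lw wE; apply: inj => //; rewrite -wE.
Qed.

Lemma hilb_mono n (j i : nat) : (hilb L n j%:Z <= hilb L n (j + i)%N%:Z)%N.
Proof.
elim: i => [|i IH]; first by rewrite addn0.
apply: leq_trans IH _; rewrite addnS.
have -> : (j + i).+1%:Z = (j + i)%N%:Z + 1 by lia.
by apply: leq_trans (hilb_step n _); exact: leq_addl.
Qed.

Lemma sum_hilb_addX n (s : nat) : (\sum_(j < s.+1) hilb La n j%:Z <= hilb L n s%:Z)%N.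
Proof.
elim: s => [|s IH]; first by rewrite big_ord1; exact: hilb_addX.
rewrite big_ord_recr /=; apply: leq_trans (leq_add IH (leqnn _)) _.
have -> : s.+1%:Z = s%:Z + 1 by lia.
by rewrite addnC; exact: hilb_step.
Qed.

(** The pieces of rees / L do not shrink under multiplication by 'X_l, hence a
    single one is at most an average of the following ones. *)
Lemma average_hilb D e s N : growth L D e ->
  (N.+1 * \sum_(n < s.+1) hilb L n s%:Z <= D * (s + N).+1 ^ e)%N.
Proof.
move=> gr; apply: leq_trans (gr (s + N)%N).
apply: leq_trans (@sum_widen (fun n => \sum_(j < (s + N).+1) hilb L n j%:Z)%N s.+1 _ _);
  last by rewrite ltnS leq_addr.
rewrite big_distrr /=; apply: leq_sum => n _.
rewrite -addnS; apply: leq_trans (@sum_shift (fun j => hilb L n j%:Z) s N.+1).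
rewrite -[X in (X * _)%N]card_ord -sum_nat_const.
by apply: leq_sum => t _; exact: hilb_mono.
Qed.

(** The exponent drops by one: the sum over j telescopes by injectivity, to a
    single column of the Hilbert function. *)
Lemma growth_addX_inj D e : growth L D e.+1 -> growth La (D * 2 ^ e.+1) e.
Proof.
move=> gr s; apply: (@leq_trans (\sum_(n < s.+1) hilb L n s%:Z)%N).
  by apply: leq_sum => n _; exact: sum_hilb_addX.
rewrite -(leq_pmul2l (ltn0Sn s)); apply: leq_trans (average_hilb s s gr) _.
apply: (@leq_trans (D * (2 * s.+1) ^ e.+1)%N).
  by rewrite leq_mul2l leq_exp2r_weak ?orbT //; lia.
by rewrite expnMn (expnS s.+1) eq_leq //; ring.
Qed.

(** Exponent 0 leaves no room for the multiples of an 'X_l not in L. *)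
Lemma growth0_X D : growth L D 0 -> L 0%N 1 'X_l.
Proof.
move=> gr; have := average_hilb 1 D gr; rewrite expn0 muln1.
set x := (\sum_(n < 2) _)%N => hx.
have x0 : x = 0%N by nia.
have g0 : hilb L 0 1 = 0%N.
  by move: x0; rewrite /x big_ord_recl /= => /eqP; rewrite addn_eq0 => /andP[/eqP].
have := hilbP 0 1 hL; rewrite g0 => /dimle0P; apply.
exact: reesX.
Qed.

(** Descending induction on the internal degree, from the vanishing range: each
    of the degrees from -a to the top, linearly many, costs at most one bound of
    exponent e. *)
Lemma tame_addX_inj e : tame La e -> tame L e.+1.
Proof.
move=> [C [D [g [h v b]]]].
pose top n : int := (C * n.+1)%N%:Z.
pose f n (j : int) (r : nat) := (\sum_(u < r) g n (j + 1 + u%:Z)%R)%N.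
pose g' n j := if j <= top n then f n j `|(top n - j)%R|%N else 0%N.
have van n j : top n <= j -> coh_dimle (rees n) (L n) j 0.
  move=> hj; apply: (coh_vanish (l := l)); [exact: rees_gsub|exact: (rees_ideal_gsub hL)|
    exact: inj|].
  move=> j' jj'; have := h n (j' + 1); rewrite v //.
  by apply: le_lt_trans hj _; apply: le_lt_trans jj' _; rewrite ltrDl.
have down n r : coh_dimle (rees n) (L n) (top n - r%:Z) (f n (top n - r%:Z) r).
  elim: r => [|r IH]; first by rewrite /f big_ord0; apply: van; rewrite subr0.
  rewrite /f big_ord_recl addr0 addnC; apply: (coh_step (l := l));
    [exact: rees_gsub|exact: (rees_ideal_gsub hL)|exact: inj| |exact: h].
  have -> : top n - r.+1%:Z + 1 = top n - r%:Z by lia.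
  have -> // : (\sum_(i < r) g n (top n - r%:Z + (lift ord0 i)%:Z)%R = f n (top n - r%:Z)%R r)%N.
  by apply: eq_bigr => u _; congr g; rewrite lift0 intS addrA.
exists C, (C.+1 * D)%N, g'; split.
- move=> n j; rewrite /g'; case: leP => [jt|/ltW]; last exact: van.
  have := down n `|top n - j|%N; have -> // : top n - `|top n - j|%N%:Z = j.
  by rewrite gez0_abs ?subr_ge0 // opprB addrC subrK.
- by move=> n j hj; rewrite /g' leNgt hj.
- move=> n a N.
  (* The number of degrees from -a to top n. *)
  pose U := (C * n.+1 + a + 1)%N.
  have g'0 m t : (m < n.+1)%N -> (U <= t)%N -> g' m (t%:Z - a%:Z)%R = 0%N.
    move=> mn Ut; rewrite /g' /top ifN // -ltNge.
    have : (C * m.+1 <= C * n.+1)%N by rewrite leq_mul2l mn orbT.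
    by rewrite /U in Ut *; lia.
  have g'U m t : (m < n.+1)%N -> (g' m (t%:Z - a%:Z)%R <= \sum_(u < U) g m (u%:Z - a%:Z)%R)%N.
    move=> mn; rewrite /g'; case: ifP => // jt.
    have mn' : (C * m.+1 <= C * n.+1)%N by rewrite leq_mul2l mn orbT.
    apply: leq_trans (@sum_widen (fun u => g m (u%:Z - a%:Z)%R) (t.+1 + `|(top m - (t%:Z - a%:Z))%R|)%N U _).
      apply: leq_trans (@sum_shift (fun u => g m (u%:Z - a%:Z)%R) t.+1 _).
      apply: leq_sum => u _; rewrite (_ : _ - _ + 1 + _ = (t.+1 + u)%N%:Z - a%:Z) //.
      by lia.
    by rewrite /U; move: jt; rewrite /top; lia.
  apply: (@leq_trans (\sum_(m < n.+1) \sum_(t < U) \sum_(u < U) g m (u%:Z - a%:Z)%R)%N).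
    apply: leq_sum => m _.
    apply: leq_trans (@sum_truncate (fun t => g' m (t%:Z - a%:Z)%R) N U _) _.
      by move=> t; exact: g'0.
    by apply: leq_sum => t _; exact: g'U.
  under eq_bigr => m _ do rewrite sum_nat_const card_ord.
  rewrite -big_distrr /=; apply: leq_trans (leq_mul (leqnn U) (b n a U)) _.
  rewrite expnS mulnA [X in (_ <= X)%N]mulnA leq_mul2r -[(C.+1 * D * _)%N]mulnAC.
  by rewrite leq_mul2r /U; apply/orP; right; apply/orP; right; nia.
Qed.

End Injective.
End Step.

(** Noetherian induction: modulo the torsion case, some variable 'X_l is not in
    L, and either it is injective modulo L, or L is replaced by the larger
    ideals L : 'X_l and L + 'X_l. *)
Theorem tame_rees L : rees_ideal L -> forall e D, growth L D e -> tame L e.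
Proof.
move: L; apply: (rees_induction homI) => L hL IH e D gr.
have [[l nX]|noX] := pselect (exists l, ~ L 0%N 1 'X_l); last first.
  apply: tame_torsion gr => // l; apply: contrapT => nX; apply: noX.
  by exists l.
have IHa := IH _ (rees_ideal_addX l hL) (@ideal_sub_addX L l).
have {}IHa : forall e D, growth (fun n => addX l (rees n) (L n)) D e ->
    tame (fun n => addX l (rees n) (L n)) e.
  by apply: IHa; exists 0%N, 1, 'X_l; split=> //; exact: (addX_varX _ hL).
have [[n [j [m [Km Lm nLm]]]]|noninj] := pselect (exists n j m,
    [/\ rees n j m, L n (j + 1) ('X_l *: m) & ~ L n j m]).
  apply: (tame_colonX_addX (l := l) hL); last exact: (IHa _ _ (growth_addX _ hL gr)).
  apply: IH (rees_ideal_colonX l hL) _ _ _ _ (growth_colonX l hL gr).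
    move=> n' j' v Lv; split; first exact: (rees_ideal_sub hL).
    by case: (rees_ideal_gsub hL n') => _; apply.
  by exists n, j, m; split.
have inj n j m : rees n j m -> L n (j + 1) ('X_l *: m) -> L n j m.
  move=> Km Lm; apply: contrapT => nLm; apply: noninj.
  by exists n, j, m; split.
case: e gr => [gr|e gr]; first by case: nX; exact: (growth0_X hL inj gr).
apply: (tame_addX_inj hL inj); apply: IHa.
exact: (growth_addX_inj hL inj gr).
Qed.

End CohomologyGrowth.

(** * Comparison with the quotients by powers of an ideal *)

Section LinearMaps.
Local Open Scope classical_set_scope.
Local Open Scope ring_scope.
Variables (k : fieldType) (d : nat).
Local Notation R := {mpoly k[d]}.
Variables (M M' : lmodType R) (phi : M -> M').
Hypothesis phiL : forall (r : R) u v, phi (r *: u + v) = r *: phi u + phi v.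

(** Defined on chosen representatives of fractions; [cech_map_fam] shows that
    they do not matter. *)
Definition cech_map (c : cech M) : cech M' :=
  fun S => Defs.frac (varprod k S) (phi (locnum (c S))) (locexp (c S)).

Lemma lin0 : phi 0 = 0.
Proof. by have := phiL (-1) 0 0; rewrite scaler0 addr0 scaleN1r addNr. Qed.

Lemma linZ (r : R) u : phi (r *: u) = r *: phi u.
Proof. by have := phiL r u 0; rewrite lin0 !addr0. Qed.

Lemma linD u v : phi (u + v) = phi u + phi v.
Proof. by have := phiL 1 u v; rewrite !scale1r. Qed.

Lemma cech_map_fam a m : cech_map (fam a m) = fam a (phi \o m).
Proof.
apply: functional_extensionality_dep => S; rewrite /cech_map {1 2}/fam.
have /fracP[c hc] := fracK (Defs.frac (varprod k S) (m S) a).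
by apply/fracP; exists c; rewrite -!linZ hc.
Qed.

Lemma cech_map_linear (r : R) c c' :
  cech_map (r *: c + c') = r *: cech_map c + cech_map c'.
Proof.
have [a [m ->]] := cech_fam c; have [a' [m' ->]] := cech_fam c'.
rewrite -(fam_expand a a') -(fam_expand a' a) (addnC a' a) fam_linear !cech_map_fam.
rewrite fam_linear; congr fam; apply: functional_extensionality_dep => S /=.
exact: phiL.
Qed.

Lemma cech_map_diff c : cech_map (cech_diff c) = cech_diff (cech_map c).
Proof.
have [a [m ->]] := cech_fam c; rewrite cech_diff_fam !cech_map_fam cech_diff_fam.
congr fam; apply: functional_extensionality_dep => S /=; rewrite /koszul.
rewrite (big_morph phi linD lin0); apply: eq_bigr => l _.
by rewrite !linZ.
Qed.

End LinearMaps.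

Section LengthBound.
Local Open Scope classical_set_scope.
Local Open Scope ring_scope.
Variables (k : fieldType) (d : nat).
Local Notation R := {mpoly k[d]}.
Variable V : lmodType R.

Lemma ksub_set0 : ksub ([set 0] : set V).
Proof. by split=> // c u v -> ->; rewrite /= scaler0 addr0. Qed.

Lemma dimle_add (Z1 Z2 B : set V) p q : ksub B -> dimle Z1 B p -> dimle Z2 B q ->
  dimle [set z | exists z1 z2, [/\ Z1 z1, Z2 z2 & z = z1 + z2]] B (p + q).
Proof.
move=> hB [v1 h1] [v2 h2].
exists (fun t => if (t < p)%N then v1 t else v2 (t - p)%N) => _ [z1 [z2 [/h1[c1 b1] /h2[c2 b2] ->]]].
exists (fun t => if (t < p)%N then c1 t else c2 (t - p)%N).
rewrite big_split_ord /=.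
rewrite (sum_if_scale _ c1 (fun t => c2 (t - p)%N) v1 (fun t => v2 (t - p)%N)).
have -> : \sum_(t < q) (if (p + t < p)%N then c1 (p + t)%N else c2 (p + t - p)%N)%:MP
    *: (if (p + t < p)%N then v1 (p + t)%N else v2 (p + t - p)%N) =
  \sum_(t < q) (c2 t)%:MP *: v2 t.
  by apply: eq_bigr => t _; rewrite ltnNge leq_addr /= addKn.
by rewrite opprD addrACA; exact: ksubD.
Qed.

Lemma ge_part_dimle (P : int -> set V) (g : int -> nat) (a : int) N :
  (forall j, P j 0) -> (forall j, dimle (P j) [set 0] (g j)) ->
  (forall t, (N <= t)%N -> g (a + t%:Z) = 0%N) ->
  dimle (ge_part P a) [set 0] (\sum_(t < N) g (a + t%:Z)%R)%N.
Proof.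
move=> P0 hP g0.
have part n : dimle [set x | exists h : nat -> V,
    (forall t, P (a + t%:Z) (h t)) /\ x = \sum_(t < n) h t] [set 0]
    (\sum_(t < n) g (a + t%:Z)%R)%N.
  elim: n => [|n IH].
    by rewrite big_ord0; apply: dimle0 => z [h [_ ->]]; rewrite big_ord0.
  rewrite big_ord_recr /=; apply: dimle_sub (dimle_add ksub_set0 IH (hP _)) => //.
  move=> z [h [hh ->]]; rewrite big_ord_recr /=.
  by exists (\sum_(t < n) h t), (h n); split=> //; exists h.
apply: dimle_sub (part N) => // z [s [h [hh ->]]].
have h0 t : (N <= t)%N -> h t = 0.
  by move=> Nt; have := hP (a + t%:Z); rewrite g0 // => /dimle0P; apply.
exists (fun t => if (t < s)%N then h t else 0); split.
  by move=> t; case: ifP.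
have [sN|Ns] := leqP s N.
  by rewrite (big_ord_widen N h) // big_mkcond.
rewrite -(subnKC (ltnW Ns)) big_split_ord /= [X in _ + X]big1 ?addr0.
  by apply: eq_bigr => t _; rewrite (leq_trans (ltn_ord t)) // subnKC // ltnW.
by move=> t _; rewrite h0 // leq_addr.
Qed.

(** Dimension increases strictly along a chain of submodules. *)
Lemma mlength_le (Real : realType) (P : set V) n :
  dimle P [set 0] n -> (mlength Real P <= n%:R%:E)%E.
Proof.
move=> dP; apply: ub_ereal_sup => _ [l [N [NP chain]] <-].
rewrite lee_fin ler_nat; pose W t : set V := [set x | x \in N t].
have hW t : ksub (W t).
  split; first exact: (@rpred0 _ (N t)).
  move=> c u v Nu Nv; apply: (@rpredD _ (N t)) => //.
  exact: (@rpredZ _ _ (N t)).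
have dW t : (t <= l)%N -> dimle (W t) [set 0] n.
  by move=> tl; apply: dimle_sub dP => // z; exact: NP.
suff main t : (t <= l)%N -> (t <= kdim (W t) [set 0%R])%N.
  by apply: leq_trans (main l (leqnn l)) _; apply: kdim_le; exact: dW.
elim: t => [//|t IH] tl; have [sub [x Nx nNx]] := chain t tl.
have split_t : (kdim (W t.+1) (W t) + kdim (W t) [set 0%R] <= kdim (W t.+1) [set 0%R])%N.
  apply: kdim_split (dW _ tl) => //; first exact: ksub_set0.
  by move=> z ->; exact: (ksub0 (hW t)).
apply: leq_trans split_t; rewrite -add1n leq_add ?IH ?(ltnW tl) //.
rewrite lt0n; apply/eqP => k0.
have := @kdimP _ _ _ (W t.+1) (W t) n; rewrite k0 => /(_ _)/dimle0P h.
move/negP: nNx; apply; apply: h => //.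
apply: dimle_sub (dW _ tl) => // z ->; exact: (ksub0 (hW t)).
Qed.

End LengthBound.

Section PowersOfIdeals.
Local Open Scope classical_set_scope.
Local Open Scope ring_scope.
Variables (k : fieldType) (d : nat).
Local Notation R := {mpoly k[d]}.
Variable (I : submodClosed R^o).
Hypothesis homI : homogeneous_ideal I.
Local Notation rees := (rees I).

Lemma rees_decr n j v : rees n.+1 j v -> rees n j v.
Proof. by case=> pv Iv; split=> //; exact: ideal_power_decr. Qed.

Lemma rees_ideal_succ : rees_ideal I (fun n => rees n.+1).
Proof.
split=> [n|n j v|n m i j u v Ku Kv]; [exact: rees_gsub|exact: rees_decr|].
by rewrite -addnS; exact: reesM.
Qed.

(** For L n = I^(n+1), rees / L is the associated graded ring of I. In each degree
    its pieces are the successive quotients of a filtration of R, so that its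
    cumulative Hilbert function is bounded by that of R. *)
Lemma growth_gr : growth I (fun n => rees n.+1) 1 d.
Proof.
move=> s; rewrite mul1n; apply: leq_trans (sum_card_monomials d s).
rewrite exchange_big /=; apply: leq_sum => j _.
have js : (j <= s)%N by rewrite -ltnS.
have fin n : dimle (rees 0 j%:Z) (rees n j%:Z) #|@monomials d s j|.
  apply: dimle_sub (piece_dimle k d js) => [z []//|z ->].
  exact: (ksub0 (gsub_ksub _ (rees_gsub I n))).
apply: leq_trans (kdim_le (fin s.+1)).
move: {j}(j : nat) {js} fin => j fin.
suff main N : (\sum_(n < N) hilb I (fun n => rees n.+1) n j%:Z <=
    kdim (rees 0 j%:Z) (rees N j%:Z))%N by exact: main.
elim: N => [|n IH]; first by rewrite big_ord0.
rewrite big_ord_recr /=; apply: leq_trans (leq_add IH (leqnn _)) _.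
have sub0 m z : rees m j%:Z z -> rees 0 j%:Z z.
  by elim: m => // m IHm /rees_decr.
apply: kdim_split (fin n.+1); try exact: (gsub_ksub _ (rees_gsub I _)).
  by move=> z; exact: rees_decr.
exact: sub0.
Qed.

(** R / I^n is filtered by the pieces I^m / I^(m+1), m < n, of the associated graded
    ring; the bound for these is already cumulative in m. *)
Lemma quotient_cohomology_bound : exists C D (G : nat -> int -> nat),
  [/\ forall n j, coh_dimle (rees 0) (rees n) j (G n j),
      forall n j, (C * n)%N%:Z < j -> G n j = 0%N &
      forall n a N, (\sum_(t < N) G n (t%:Z - a%:Z)%R <= D * (n + a) ^ d)%N].
Proof.
have [C [D [g [hg vg bg]]]] := tame_rees homI rees_ideal_succ growth_gr.
exists C, D, (fun n j => \sum_(m < n) g m j)%N; split.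
- have sub0 m j z : rees m j z -> rees 0 j z.
    by elim: m => // m IHm /rees_decr.
  elim=> [|n IH] j.
    rewrite big_ord0; apply: dimle0 => z [Kz _]; apply: cobnd_sub => //.
    exact: rees_gsub.
  rewrite big_ord_recr /=; apply: (coh_ext (K := rees n)); try exact: rees_gsub.
  + exact: rees_decr.
  + exact: sub0.
  + exact: IH.
  + exact: hg.
- move=> n j hj; rewrite big1 // => m _; apply: vg; apply: le_lt_trans hj.
  by rewrite lez_nat leq_mul2l ltn_ord orbT.
- move=> [|n] a N; first by rewrite big1 // => t _; rewrite big_ord0.
  by rewrite exchange_big /= addSn; exact: bg.
Qed.

Section Comparison.
Variables (n i : nat).
Local Notation J := (ideal_power I n).
Local Notation Q := (quotmod J).
Local Notation pQ := (quot_piece J).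
Let cl : R^o -> Q := mclass J.

Lemma cl_linear (r : R) u v : cl (r *: u + v) = r *: cl u + cl v.
Proof. by rewrite /cl mclassD -mclass_scale. Qed.

Lemma mclass0 (S : comNzRingType) (V : lmodType S) (N : submodClosed V) : mclass N 0 = 0.
Proof. by apply: (addrI (mclass N 0)); rewrite -mclassD !addr0. Qed.

Lemma cl0P u : cl u = 0 <-> u \in J.
Proof. by rewrite -(mclass0 J) mclassP subr0. Qed.

Lemma quot_piece_gsub : gsub pQ.
Proof.
split=> [j|j l _ [p Pp <-]]; last first.
  exists ('X_l *: p); last exact: (linZ cl_linear).
  by rewrite addrC; apply: pieceM => //; exact: pieceX.
split; first by exists 0; [exact: (ksub0 (@piece_ksub k d j))|exact: mclass0].
move=> c _ _ [p Pp <-] [q Pq <-]; exists (c%:MP *: p + q); last exact: cl_linear.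
by case: (@piece_ksub k d j) => _; apply.
Qed.

Lemma lift_cochain j z : cech_piece pQ j z ->
  exists2 c, cech_piece (rees 0) j c & z = cech_map cl c.
Proof.
move=> /(cech_pieceP quot_piece_gsub)[a /(_ _ (leqnn _))[m -> hm]].
have /choice[p hp] (S : {set 'I_d}) : exists p : R^o, mpoly_piece (j + (a * #|S|)%N%:Z) p /\ m S = cl p.
  by have [p Pp <-] := hm S; exists p.
exists (fam a p).
  by apply: fam_piece => S; case: (hp S) => Pp _; split=> //; exact: ideal_power0.
rewrite (cech_map_fam cl_linear); congr fam.
by apply: functional_extensionality_dep => S; case: (hp S).
Qed.

Lemma cech_map_eq0 j c : cech_piece (rees 0) j c -> cech_map cl c = 0 ->
  cech_piece (rees n) j c.
Proof.
move=> /(cech_pieceP (rees_gsub I 0))[a /(_ _ (leqnn _))[m -> hm]].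
rewrite (cech_map_fam cl_linear) => h S.
have /fracP[e] : Defs.frac (varprod k S) (cl (m S)) a = Defs.frac (varprod k S) 0 0.
  by have := congr1 (fun f => f S) h.
rewrite addn0 scaler0 -(linZ cl_linear) => /cl0P Jm.
exists (varprod k S ^+ e *: m S), (a + e)%N; split; last by rewrite frac_expand.
have [+ _] := gsub_varprodX S e (rees_gsub I 0) (hm S).
by rewrite -addrA -PoszD -mulnDl.
Qed.

Lemma cech_map_rees j c : cech_piece (rees n) j c -> cech_map cl c = 0.
Proof.
move=> /(cech_pieceP (rees_gsub I n))[a /(_ _ (leqnn _))[m -> hm]].
rewrite (cech_map_fam cl_linear); apply: functional_extensionality_dep => S.
by rewrite /fam /=; have [_ /cl0P ->] := hm S; rewrite frac0.
Qed.

Lemma lc_piece_ksub j : ksub (lc_piece pQ i j).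
Proof.
have hQ := cech_piece_ksub j quot_piece_gsub; split.
  exists 0; last by rewrite mclass0.
  by split; [split=> //; exact: cech_diff0|exact: ksub0].
move=> c _ _ [z [[tz dz] Pz] ->] [z' [[tz' dz'] Pz'] ->].
exists (c%:MP *: z + z'); last by rewrite mclassD -mclass_scale.
split; last by case: hQ => _; apply.
split; last by rewrite cech_diff_linear dz dz' scaler0 addr0.
by move=> S hS; transitivity (c%:MP *: z S + z' S) => //; rewrite tz // tz' // scaler0 addr0.
Qed.

(** The total cohomology controls each index: a coboundary lying in the i-th term
    is the coboundary of the (i-1)-th component of b. *)
Lemma boundary_term (b : cech Q) : cech_term i (cech_diff b) ->
  mclass (cech_boundary i) (cech_diff b) = 0.
Proof.
move=> tb; rewrite -(mclass0 (cech_boundary i)); apply/mclassP; rewrite subr0.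
apply/asboolP; exists (fun S : {set 'I_d} => if #|S|.+1 == i then b S else 0) => [S|].
  by move=> /negbTE ->.
apply: functional_extensionality_dep => S; have [cS|cS] := eqVneq #|S| i.
  apply: eq_bigr => l lS; case: ifP => //.
  by rewrite -cS (cardsD1 l S) lS eqxx.
rewrite tb // /cech_diff big1 // => l lS; rewrite ifN; last first.
  by move: cS; rewrite (cardsD1 l S) lS.
rewrite (_ : loc_map _ _ _ = 0) ?scaler0 //.
transitivity (loc_map 'X_l (varprod k S) (Defs.frac (varprod k (S :\ l)) (0 : Q) 0)).
  by [].
by rewrite (loc_mapE (varprodD1 k lS)) scaler0 frac0.
Qed.

(** A cocycle of R / I^n lifts to a cochain of R that is a cocycle modulo I^n; the
    relation between classes and lifts is linear and detects vanishing. *)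
Lemma lc_piece_dimle j p : coh_dimle (rees 0) (rees n) j p ->
  dimle (lc_piece pQ i j) [set 0] p.
Proof.
have h0 := rees_gsub I 0; have hn := rees_gsub I n.
pose rho (h : lc_ambient Q i) c := exists z,
  [/\ cech_cocycle i z, h = mclass (cech_boundary i) z & z = cech_map cl c].
apply: (dimle_rel0 (rho := rho) (lc_piece_ksub j) (ksub_set0 _)
  (cocyc_ksub j h0 hn) (cobnd_ksub j h0 hn)).
- exists 0; split; [by split=> //; exact: cech_diff0|by rewrite mclass0|].
  by have := cech_map_linear cl_linear (-1) 0 0;
    rewrite scaler0 addr0 scaleN1r addNr => ->.
- move=> c h h' u u' [z [[tz dz] -> zE]] [z' [[tz' dz'] -> zE']].
  exists (c%:MP *: z + z'); split.
  + split; last by rewrite cech_diff_linear dz dz' scaler0 addr0.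
    by move=> S hS; transitivity (c%:MP *: z S + z' S) => //; rewrite tz // tz' // scaler0 addr0.
  + by rewrite mclassD -mclass_scale.
  + by rewrite (cech_map_linear cl_linear) zE zE'.
- move=> _ [z [[tz dz] /lift_cochain[c Kc zE]] ->]; exists c; last by exists z.
  split=> //; apply: cech_map_eq0; first exact: cech_piece_diff.
  by rewrite (cech_map_diff cl_linear) -zE.
- move=> _ c _ [b [l [Kb Ll cE]]] [z [[tz _] -> zE]].
  have zb : z = cech_diff (cech_map cl b).
    rewrite zE cE -[cech_diff b]scale1r (cech_map_linear cl_linear) scale1r.
    by rewrite (cech_map_rees Ll) addr0 (cech_map_diff cl_linear).
  by rewrite zb in tz *; exact: boundary_term.
Qed.

End Comparison.
End PowersOfIdeals.

Unset Implicit Arguments.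
Set Strict Implicit.
Set Printing Implicit Defensive.

Theorem theoremC (Real : realType) (k : fieldType) (d : nat)
    (I : submodClosed {mpoly k[d]}^o) (homI : homogeneous_ideal I)
    (i : nat) (alpha : int) :
  (limn_esup (fun n : nat =>
     mlength Real (ge_part (lc_piece (quot_piece (ideal_power I n)) i)
                           (- (alpha * n%:Z)))
     / (n%:R ^+ d)%:E) < +oo)%E.
Proof.
have [C [D [G [hG vG bG]]]] := quotient_cohomology_bound homI.
pose A := `|alpha|%N; pose B := (D * A.+1 ^ d)%N.
have bound n : (mlength Real (ge_part (lc_piece (quot_piece (ideal_power I n)) i)
    (- (alpha * n%:Z))) <= (B * n ^ d)%N%:R%:E)%E.
  set a0 := - (alpha * n%:Z); pose b := (A * n)%N.
  have a0b : - b%:Z <= a0.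
    rewrite lerN2 /b PoszM; apply: ler_wpM2r => //.
    by rewrite /A abszE ler_norm.
  (* Degrees a0 + N and above are beyond C n; the window is extended downwards by
     s degrees, to start at -b. *)
  pose N := (C * n + b + 1)%N; pose s := `|(b%:Z + a0)%R|%N.
  have sE : s%:Z = b%:Z + a0 by rewrite gez0_abs // -lerBlDl sub0r.
  apply: mlength_le; apply: (@dimle_le _ _ _ _ _ (\sum_(t < N) G n (a0 + t%:Z)%R)%N).
    apply: leq_trans (_ : \sum_(t < s + N) G n (t%:Z - b%:Z)%R <= _)%N.
      apply: leq_trans (@sum_shift (fun t => G n (t%:Z - b%:Z)%R) s N).
      apply: leq_sum => t _; rewrite eq_leq //; congr (G n _).
      by rewrite PoszD sE; ring.
    apply: leq_trans (bG n b (s + N)%N) _; rewrite /B /b -mulnA -expnMn.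
    by rewrite leq_mul2l leq_exp2r_weak ?orbT //; lia.
  apply: ge_part_dimle => [j|j|t Nt].
  - exact: (ksub0 (lc_piece_ksub I n i j)).
  - exact: lc_piece_dimle (hG n j).
  - by apply: vG; rewrite /N in Nt; lia.
rewrite /limn_esup /ereal_normedtype.limf_esup.
apply: (@le_lt_trans _ _ (B%:R%:E : \bar Real)); last exact: ltry.
pose u n := (mlength Real (ge_part (lc_piece (quot_piece (ideal_power I n)) i)
                           (- (alpha * n%:Z))) / (n%:R ^+ d)%:E)%E.
apply: (@le_trans _ _ (ereal_sup [set u n | n in [set n | (0 < n)%N]]%classic)).
  apply: ereal_inf_lbound; exists [set n | (0 < n)%N]%classic => //.
  by exists 1%N.
apply: ub_ereal_sup => _ [n /= n0 <-]; rewrite /u.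
have nd : (0 : Real) < n%:R ^+ d by rewrite exprn_gt0 // ltr0n.
rewrite inver gt_eqF // lee_pdivrMr //; apply: le_trans (bound n) _.
by rewrite -EFinM lee_fin natrM natrX.
Qed.
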